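(* Let $\mu,L,M,L_2>0$ and let $f:\mathbb{R}^n\to\mathbb{R}$ be three times continuously differentiable, $\mu$-strongly convex, with $L$-Lipschitz continuous gradient, $M$-self-concordant, and with $L_2$-Lipschitz continuous Hessian. Let $\tilde M=L_2/(2\mu^{3/2})$ and assume $M\le\tilde M$. Let $\varkappa=L/\mu$, let $\mathbf{x}_*$ be the unique minimizer of $f$, let $\mathbf{x}_0\in\mathbb{R}^n$, let $\mathbf{B}_0\in\mathbb{R}^{n\times n}$ be symmetric positive definite, and let $(\mathbf{x}_k)_{k\ge0}$ be generated by the smoothness aided adaptive BFGS algorithm with parameters $M,L$ (with $\nabla f(\mathbf{x}_k)\ne\mathbf{0}$ for all $k$). Put $\Delta=f(\mathbf{x}_0)-f(\mathbf{x}_* )$, $\bar{\mathbf{B}}_0=\mathbf{B}_0/L$, $\tilde{\mathbf{B}}_0=\nabla^2 f(\mathbf{x}_* )^{-1/2}\,\mathbf{B}_0\,\nabla^2 f(\mathbf{x}_* )^{-1/2}$ and $\Gamma=(1+\sqrt2\,M\sqrt{\Delta})^2$. Then for all integers $k\ge1$, $$\frac{f(\mathbf{x}_k)-f(\mathbf{x}_* )}{f(\mathbf{x}_0)-f(\mathbf{x}_* )}\le\left(\frac{\Psi(\tilde{\mathbf{B}}_0)+8\sqrt2\,\tilde M\sqrt{\Delta}\,\bigl(2\Psi(\bar{\mathbf{B}}_0)+1+4\varkappa\min\{\Gamma,\varkappa\}\bigr)}{k}\right)^{k}.$$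
   Context: $\|\cdot\|$ is the Euclidean norm for vectors and the spectral norm for matrices, and $\|\mathbf{d}\|_{\mathbf{x}}=(\mathbf{d}^\top\nabla^2 f(\mathbf{x})\mathbf{d})^{1/2}$. The function $f$ is $\mu$-strongly convex if $f(\lambda\mathbf{x}+(1-\lambda)\mathbf{y})\le\lambda f(\mathbf{x})+(1-\lambda)f(\mathbf{y})-\frac{\lambda(1-\lambda)\mu}{2}\|\mathbf{x}-\mathbf{y}\|^2$ for all $\mathbf{x},\mathbf{y}\in\mathbb{R}^n$, $\lambda\in[0,1]$. It has $L$-Lipschitz gradient if $\|\nabla f(\mathbf{x})-\nabla f(\mathbf{y})\|\le L\|\mathbf{x}-\mathbf{y}\|$ for all $\mathbf{x},\mathbf{y}$. A convex $f$ is $M$-self-concordant if $|\nabla^3 f(\mathbf{x})[\mathbf{d},\mathbf{d},\mathbf{d}]|\le 2M\|\mathbf{d}\|_{\mathbf{x}}^3$ for all $\mathbf{x},\mathbf{d}$. It has $L_2$-Lipschitz Hessian if $\|\nabla^2 f(\mathbf{x})-\nabla^2 f(\mathbf{y})\|\le L_2\|\mathbf{x}-\mathbf{y}\|$ for all $\mathbf{x},\mathbf{y}$. For a symmetric positive definite $n\times n$ matrix $\mathbf{A}$, $\Psi(\mathbf{A})=\mathrm{Tr}(\mathbf{A})-\ln\det(\mathbf{A})-n$. Smoothness aided adaptive BFGS algorithm: for $k=0,1,2,\dots$ set $\mathbf{g}_k=\nabla f(\mathbf{x}_k)$, $\mathbf{d}_k=-\mathbf{B}_k^{-1}\mathbf{g}_k$,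 $\eta_k=-\mathbf{g}_k^\top\mathbf{d}_k/\|\mathbf{d}_k\|_{\mathbf{x}_k}$, $\alpha_k=\|\mathbf{d}_k\|_{\mathbf{x}_k}/(\sqrt L\,\|\mathbf{d}_k\|)$, $$\tilde t_k=\begin{cases}\dfrac{\eta_k}{(1+M\eta_k)\|\mathbf{d}_k\|_{\mathbf{x}_k}},&(1+M\eta_k)\alpha_k\le1,\\[2mm]\dfrac{M\eta_k\alpha_k^2+(1-\alpha_k)^2}{M\|\mathbf{d}_k\|_{\mathbf{x}_k}},&(1+M\eta_k)\alpha_k>1,\end{cases}$$ $\mathbf{x}_{k+1}=\mathbf{x}_k+\tilde t_k\mathbf{d}_k$, $\mathbf{s}_k=\mathbf{x}_{k+1}-\mathbf{x}_k$, $\mathbf{y}_k=\nabla f(\mathbf{x}_{k+1})-\nabla f(\mathbf{x}_k)$, and $$\mathbf{B}_{k+1}=\mathbf{B}_k-\frac{\mathbf{B}_k\mathbf{s}_k\mathbf{s}_k^\top\mathbf{B}_k}{\mathbf{s}_k^\top\mathbf{B}_k\mathbf{s}_k}+\frac{\mathbf{y}_k\mathbf{y}_k^\top}{\mathbf{y}_k^\top\mathbf{s}_k}.$$ *)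

(* Defs.v *)
From mathcomp Require Import all_boot all_order all_algebra.
From mathcomp Require Import boolp classical_sets reals topology normedtype.
From mathcomp Require Import derive exp convex.
Import Order.TTheory GRing.Theory Num.Theory.
Import numFieldNormedType.Exports.

Set Implicit Arguments.
Unset Strict Implicit.
Unset Printing Implicit Defensive.

Local Open Scope classical_set_scope.
Local Open Scope ring_scope.

Section Euclidean.
Context {R : realType} {n : nat}.
Implicit Types (u v : 'cV[R]_n) (A S : 'M[R]_n).

Definition dot u v : R := (u^T *m v) 0 0.

(* The library norm [`|v|] on matrices is the sup norm of the entries, hence
   this separate Euclidean norm. *)
Definition enorm v : R := Num.sqrt (dot v v).

(* The operator norm induced by [enorm]. *)
Definition spectral_norm A : R :=
  sup [set enorm (A *m v) | v in [set v | enorm v <= 1]].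

Definition posdefmx A : Prop :=
  A^T = A /\ forall v, v != 0 -> 0 < dot v (A *m v).

(* The principal square root: a symmetric positive definite [A] has exactly one
   symmetric positive definite square root. The value is unspecified-but-total
   for the other matrices. *)
Definition sqrtmx A : 'M[R]_n := xget 0 [set S | posdefmx S /\ S *m S = A].

Definition Psi A : R := \tr A - ln (\det A) - n%:R.

End Euclidean.

Section Calculus.
Context {R : realType} {n : nat}.
Implicit Types (f : 'cV[R]_n -> R) (x d : 'cV[R]_n).

Definition partial (i : 'I_n) f : 'cV[R]_n -> R := 'D_(delta_mx i 0) f.

Fixpoint cont_diff (k : nat) f : Prop :=
  continuous f /\
  if k is k'.+1 then
    forall i : 'I_n,
      (forall x, derivable f x (delta_mx i 0)) /\ cont_diff k' (partial i f)
  else True.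

Definition grad f x : 'cV[R]_n := \col_i partial i f x.

Definition hess f x : 'M[R]_n := \matrix_(i, j) partial j (partial i f) x.

Definition third_form f x (d1 d2 d3 : 'cV[R]_n) : R :=
  \sum_(i < n) \sum_(j < n) \sum_(k < n)
    partial k (partial j (partial i f)) x * d1 i 0 * d2 j 0 * d3 k 0.

Definition local_norm f x d : R := Num.sqrt (dot d (hess f x *m d)).

Definition strongly_convex (mu : R) f : Prop :=
  forall x y (lam : R), 0 <= lam <= 1 ->
    f (lam *: x + (1 - lam) *: y) <=
    lam * f x + (1 - lam) * f y
      - lam * (1 - lam) * mu / 2 * enorm (x - y) ^+ 2.

Definition lipschitz_grad (L : R) f : Prop :=
  forall x y, enorm (grad f x - grad f y) <= L * enorm (x - y).

Definition lipschitz_hess (L2 : R) f : Prop :=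
  forall x y, spectral_norm (hess f x - hess f y) <= L2 * enorm (x - y).

Definition self_concordant (M : R) f : Prop :=
  convex_function [set: 'cV[R]_n] f /\
  forall x d, `|third_form f x d d d| <= 2 * M * local_norm f x d ^+ 3.

End Calculus.

Section BFGS.
Context {R : realType} {n : nat}.
Variables (f : 'cV[R]_n -> R) (L M : R).
Implicit Types (x s y d : 'cV[R]_n) (B : 'M[R]_n).

Definition bfgs_dir x B : 'cV[R]_n := - (invmx B *m grad f x).

Definition bfgs_eta x d : R := - dot (grad f x) d / local_norm f x d.

Definition bfgs_alpha x d : R := local_norm f x d / (Num.sqrt L * enorm d).

Definition bfgs_stepsize x d : R :=
  let eta := bfgs_eta x d in
  let alpha := bfgs_alpha x d in
  if (1 + M * eta) * alpha <= 1 then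
    eta / ((1 + M * eta) * local_norm f x d)
  else
    (M * eta * alpha ^+ 2 + (1 - alpha) ^+ 2) / (M * local_norm f x d).

Definition bfgs_update B s y : 'M[R]_n :=
  B - (dot s (B *m s))^-1 *: (B *m s *m s^T *m B) + (dot y s)^-1 *: (y *m y^T).

Definition sa_adaptive_bfgs x0 B0
    (x : nat -> 'cV[R]_n) (B : nat -> 'M[R]_n) : Prop :=
  [/\ x 0%N = x0, B 0%N = B0 &
    forall k : nat,
      let d := bfgs_dir (x k) (B k) in
      x k.+1 = x k + bfgs_stepsize (x k) d *: d /\
      B k.+1 = bfgs_update (B k) (x k.+1 - x k)
                 (grad f (x k.+1) - grad f (x k))].

End BFGS.

(* Main.v *)
(* Along a step the difference [f (x k.+1) - f (x k)], the curvature [y^T s] and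
   the slope [g^T s] are compared through one-dimensional bounds: by
   self-concordance the square root of the inverse of the second derivative of
   the restriction of [f] to a line is [M]-Lipschitz, and by smoothness this
   second derivative is at most [L ||d||^2]. The step size minimizes the
   resulting upper bound of [f].

   For a weight [S = W^(-1/2)] the BFGS update changes [Psi (S B S)] by at most
   [||S y||^2 / y^T s - 1 + ln ((g^T s)^2 / (||S g||^2 y^T s))]. Hence, writing
   [delta k = f (x k) - f xs] and [q k = ln (delta k / (delta k - delta k.+1))],
   - for [W = L I], [q k <= ln (kappa min(Gamma, kappa))] up to a telescoping
     term, so that the sum of the [sqrt (delta k)] is bounded;
   - for [W = hess f xs], [q k] is at most a multiple of [sqrt (delta k)], up to
     a telescoping term, so that the sum of the [q k] is bounded.
   Since [delta k.+1 / delta k = 1 - exp (- q k) <= q k], the inequality between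
   arithmetic and geometric means gives the superlinear rate. *)
Require Import Defs.
From mathcomp Require Import all_boot all_order all_algebra.
From mathcomp Require Import boolp classical_sets reals topology normedtype.
From mathcomp Require Import derive exp convex.
From mathcomp Require Import functions sequences realfun ring lra.
From mathcomp Require Import spectral complex.
Import Order.TTheory GRing.Theory Num.Theory.
Import numFieldNormedType.Exports.
Local Open Scope ring_scope.
Set Implicit Arguments.
Unset Strict Implicit.
Unset Printing Implicit Defensive.

(** * Derivatives of real functions *)

Section DeriveRules.
Context {R : realType}.
Implicit Types (F G : R -> R) (a b t c : R).

(** Two weights are needed because neither suffices alone. For [W = hess f xs] all factors in the
    one-step estimate tend to 1 with [delta k], so their logarithms are of order [sqrt (delta k)];
    this is summable only once some linear rate is known. For [W = L I] no closeness to [xs] is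
    required: the Hessian bound by [L] gives [||S y||^2 / y^T s <= 1], and only the constant [ln K]
    with [K = kappa min(Gamma, kappa)] remains. Since [Psi] is nonnegative, the telescoping terms
    cost at most its initial value. Once [k >= 2 Psi (B0 / L)], the mean of [exp (- q i)] over the
    first [k] steps is at least [1 / (2 K)], hence [sqrt (delta k / delta 0) <= exp (- k / (4 K))].
    The earlier indices contribute at most 1 each and the tail at most [4 K]; this is the origin of
    [2 Psi + 1 + 4 K]. The step size enters through three bounds on the slope [sigma = - g^T s]: it
    is at most [2 (f x - f x')], at most [Gamma y^T s] and at most [kappa y^T s]. In the change of
    [Psi] the step size itself cancels, because [B s = - t g]. *)

Lemma is_derive_add F G t a b : is_derive t 1 F a -> is_derive t 1 G b ->
  is_derive t 1 (fun u => F u + G u) (a + b).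
Proof. exact: is_deriveD. Qed.

Lemma is_derive_sub F G t a b : is_derive t 1 F a -> is_derive t 1 G b ->
  is_derive t 1 (fun u => F u - G u) (a - b).
Proof. exact: is_deriveB. Qed.

Lemma is_derive_mull c F t a : is_derive t 1 F a ->
  is_derive t 1 (fun u => c * F u) (c * a).
Proof. exact: is_deriveZ. Qed.

Lemma is_derive_mul F G t a b : is_derive t 1 F a -> is_derive t 1 G b ->
  is_derive t 1 (fun u => F u * G u) (F t * b + G t * a).
Proof. exact: is_deriveM. Qed.

Lemma is_derive_ln F t a : 0 < F t -> is_derive t 1 F a ->
  is_derive t 1 (fun u => ln (F u)) ((F t)^-1 * a).
Proof.
by move=> F0 dF; apply: (@is_derive1_comp _ (@ln R)); exact: is_derive1_ln.
Qed.

Lemma is_derive_inv F t a : F t != 0 -> is_derive t 1 F a ->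
  is_derive t 1 (fun u => (F u)^-1) (- (F t) ^- 2 * a).
Proof. by move=> Ft0 dF; exact: is_deriveV. Qed.

Lemma is_derive_affine a b t : is_derive t 1 (fun u => a + b * u) b.
Proof.
rewrite -[X in is_derive _ _ _ X]add0r; apply: is_derive_add.
rewrite -[X in is_derive _ _ _ X]mulr1; apply: is_derive_mull.
Qed.

(** The mean value theorem for [G - F]. It takes the place of integrating [F' <= G'] over the
    interval. *)
Lemma ler_derive F G (F' G' : R -> R) a b : a <= b ->
  (forall t, a <= t <= b -> is_derive t 1 F (F' t)) ->
  (forall t, a <= t <= b -> is_derive t 1 G (G' t)) ->
  (forall t, a <= t <= b -> F' t <= G' t) ->
  F b - F a <= G b - G a.
Proof.
move=> ab dF dG FG.
have dH t : a <= t <= b -> is_derive t 1 (fun u => G u - F u) (G' t - F' t).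
  by move=> tab; apply: is_derive_sub; [exact: dG|exact: dF].
have [t||c cab E] :=
    @MVT_segment R (fun u => G u - F u) (fun t => G' t - F' t) a b ab.
- by rewrite in_itv /= => /andP[/ltW ? /ltW ?]; apply: dH; apply/andP.
- apply: derivable_within_continuous => t; rewrite in_itv /= => tab.
  by have [] := dH t tab.
rewrite in_itv /= in cab.
rewrite -subr_ge0; have -> : G b - G a - (F b - F a) = (G b - F b) - (G a - F a).
  by ring.
by rewrite E mulr_ge0 ?subr_ge0// FG.
Qed.

End DeriveRules.

(** * Self-concordant functions of one variable *)

Section SelfConcordantLine.
Context {R : realType}.
Implicit Types t u : R.
Variables (M : R) (phi phi1 phi2 phi3 : R -> R).
Hypothesis M_gt0 : 0 < M.
Hypothesis dphi : forall t : R, is_derive t 1 phi (phi1 t).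
Hypothesis dphi1 : forall t : R, is_derive t 1 phi1 (phi2 t).
Hypothesis dphi2 : forall t : R, is_derive t 1 phi2 (phi3 t).
Hypothesis phi2_gt0 : forall t, 0 < phi2 t.
Hypothesis phi3_le : forall t, `|phi3 t| <= 2 * M * Num.sqrt (phi2 t) ^+ 3.

Variable q : R.
Hypothesis q_gt0 : 0 < q.
Hypothesis q2 : q ^+ 2 = phi2 0.

Let sqrt_phi2_0 : Num.sqrt (phi2 0) = q.
Proof. by rewrite -q2 sqrtr_sqr gtr0_norm. Qed.

Let dinvsqrt (t : R) :
  is_derive t 1 (fun u => (Num.sqrt (phi2 u))^-1)
    (- (phi3 t / (2 * Num.sqrt (phi2 t) ^+ 3))).
Proof.
have s0 : 0 < Num.sqrt (phi2 t) by rewrite sqrtr_gt0.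
have -> : - (phi3 t / (2 * Num.sqrt (phi2 t) ^+ 3)) =
    - (Num.sqrt (phi2 t)) ^- 2 * ((2 * Num.sqrt (phi2 t))^-1 * phi3 t).
  by field; rewrite gt_eqF.
apply: is_derive_inv; first by rewrite gt_eqF.
by apply: (@is_derive1_comp _ Num.sqrt phi2); exact: is_derive1_sqrt.
Qed.

Let dinvsqrt_le t : `|phi3 t / (2 * Num.sqrt (phi2 t) ^+ 3)| <= M.
Proof.
have s0 : 0 < Num.sqrt (phi2 t) by rewrite sqrtr_gt0.
have s1 : 0 < 2 * Num.sqrt (phi2 t) ^+ 3 by rewrite mulr_gt0// exprn_gt0.
rewrite normrM normfV (gtr0_norm s1) ler_pdivrMr//.
by have := phi3_le t; lra.
Qed.

Let dlin (c t : R) : is_derive t 1 (fun u => c * u) c.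
Proof. by rewrite -[X in is_derive _ _ _ X]mulr1; apply: is_derive_mull. Qed.

Let invsqrt_le t : 0 <= t -> (Num.sqrt (phi2 t))^-1 <= q^-1 + M * t.
Proof.
move=> t0; rewrite -lerBlDl.
have := ler_derive t0 (fun u _ => dinvsqrt u) (fun u _ => dlin M u).
rewrite mulr0 subr0 sqrt_phi2_0; apply=> u _.
by have := dinvsqrt_le u; rewrite ler_norml => /andP[]; lra.
Qed.

Let invsqrt_ge t : 0 <= t -> q^-1 - M * t <= (Num.sqrt (phi2 t))^-1.
Proof.
move=> t0.
have := ler_derive t0 (fun u _ => dlin (- M) u) (fun u _ => dinvsqrt u).
rewrite mulr0 subr0 sqrt_phi2_0 => h; suff : - M * t <= (Num.sqrt (phi2 t))^-1 - q^-1 by lra.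
apply: h => u _.
by have := dinvsqrt_le u; rewrite ler_norml => /andP[]; lra.
Qed.

Lemma self_concordant_ge2 t : 0 <= t ->
  phi2 0 / (1 + M * q * t) ^+ 2 <= phi2 t.
Proof.
move=> t0; have s0 : 0 < Num.sqrt (phi2 t) by rewrite sqrtr_gt0.
have Mqt : 0 <= M * q * t by apply: mulr_ge0 => //; apply: mulr_ge0; exact: ltW.
have p0 : 0 < 1 + M * q * t by rewrite ltr_wpDr.
rewrite -q2 -expr_div_n -[leRHS](sqr_sqrtr (ltW (phi2_gt0 t))).
rewrite lerXn2r ?nnegrE ?divr_ge0 ?(ltW q_gt0) ?(ltW s0) ?(ltW p0)//.
rewrite ler_pdivrMr//.
have := invsqrt_le t0; rewrite -[_^-1]div1r ler_pdivrMr// => h.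
have -> : q = q * 1 by ring.
apply: le_trans (ler_wpM2l (ltW q_gt0) h) _.
by rewrite le_eqVlt; apply/orP; left; apply/eqP; field; rewrite gt_eqF.
Qed.

(** The restriction on [t] is the range where the lower bound [q^-1 - M t] for the inverse square
    root of [phi2] stays positive and can be inverted. *)
Lemma self_concordant_le2 t : 0 <= t -> M * q * t < 1 ->
  phi2 t <= phi2 0 / (1 - M * q * t) ^+ 2.
Proof.
move=> t0 Mqt; have s0 : 0 < Num.sqrt (phi2 t) by rewrite sqrtr_gt0.
have p0 : 0 < 1 - M * q * t by rewrite subr_gt0.
rewrite -q2 -expr_div_n -[leLHS](sqr_sqrtr (ltW (phi2_gt0 t))).
rewrite lerXn2r ?nnegrE ?divr_ge0 ?(ltW q_gt0) ?(ltW s0) ?(ltW p0)//.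
rewrite ler_pdivlMr//.
have := invsqrt_ge t0; rewrite -[leRHS]div1r ler_pdivlMr// => h.
have -> : q = q * 1 by ring.
apply: le_trans (ler_wpM2l (ltW q_gt0) h).
by rewrite le_eqVlt; apply/orP; left; apply/eqP; field; rewrite gt_eqF.
Qed.

Lemma self_concordant_ge1 t : 0 <= t ->
  phi2 0 * t / (1 + M * q * t) <= phi1 t - phi1 0.
Proof.
move=> t0.
have := @ler_derive R (fun u => phi2 0 * u / (1 + M * q * u)) phi1
  (fun u => phi2 0 / (1 + M * q * u) ^+ 2) phi2 0 t t0.
rewrite !mulr0 mul0r subr0; apply => u /andP[u0 _]; last exact: self_concordant_ge2.
 have p0 : 0 < 1 + M * q * u.
  by rewrite ltr_wpDr//; apply: mulr_ge0 => //; apply: mulr_ge0; exact: ltW.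
have -> : phi2 0 / (1 + M * q * u) ^+ 2 =
  (phi2 0 * u) * (- (1 + M * q * u) ^- 2 * (M * q))
  + (1 + M * q * u)^-1 * phi2 0 by field; rewrite gt_eqF.
apply: is_derive_mul; first exact: dlin.
by apply: is_derive_inv; [rewrite gt_eqF|exact: is_derive_affine].
Qed.

Lemma self_concordant_le1 t : 0 <= t -> M * q * t < 1 ->
  phi1 t - phi1 0 <= phi2 0 * t / (1 - M * q * t).
Proof.
move=> t0 Mqt.
have := @ler_derive R phi1 (fun u => phi2 0 * u / (1 - M * q * u))
  phi2 (fun u => phi2 0 / (1 - M * q * u) ^+ 2) 0 t t0.
have p0 u : 0 <= u <= t -> 0 < 1 - M * q * u.
  move=> /andP[u0 ut]; rewrite subr_gt0; apply: le_lt_trans Mqt.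
  by rewrite ler_wpM2l//; apply: mulr_ge0; exact: ltW.
rewrite !mulr0 mul0r subr0; apply => u ut.
- have -> : phi2 0 / (1 - M * q * u) ^+ 2 =
    (phi2 0 * u) * (- (1 + (- (M * q)) * u) ^- 2 * (- (M * q)))
    + (1 + (- (M * q)) * u)^-1 * phi2 0.
    by field; have := p0 u ut; rewrite mulNr => /gt_eqF ->.
  have -> : (fun u => phi2 0 * u / (1 - M * q * u)) =
      (fun u => phi2 0 * u * (1 + (- (M * q)) * u)^-1).
    by apply/funext => v; rewrite mulNr.
  apply: is_derive_mul; first exact: dlin.
  apply: is_derive_inv; last exact: is_derive_affine.
  by rewrite mulNr gt_eqF// p0.
- apply: self_concordant_le2; first by case/andP: ut.
  by have := p0 u ut; rewrite subr_gt0.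
Qed.

(** Kept general in the sign of [c]: [c = M q] yields the antiderivative for the lower bound on
    [phi], [c = - M q] the one for the upper bound. *)
Let dlog c (u : R) : 0 < 1 + c * u ->
  is_derive u 1 (fun v => (c * v - ln (1 + c * v)) / M ^+ 2)
    ((c / M) ^+ 2 * u / (1 + c * u)).
Proof.
move=> p0.
have -> : (c / M) ^+ 2 * u / (1 + c * u) =
    M ^- 2 * (c - (1 + c * u)^-1 * c).
  by field; rewrite !gt_eqF.
have -> : (fun v => (c * v - ln (1 + c * v)) / M ^+ 2) =
    (fun v => M ^- 2 * (c * v - ln (1 + c * v))).
  by apply/funext => v; rewrite mulrC.
apply: is_derive_mull; apply: is_derive_sub; first exact: dlin.
by apply: is_derive_ln => //; exact: is_derive_affine.
Qed.

Lemma self_concordant_ge t : 0 <= t ->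
  phi1 0 * t + (M * q * t - ln (1 + M * q * t)) / M ^+ 2 <= phi t - phi 0.
Proof.
move=> t0.
have := @ler_derive R
  (fun u => phi1 0 * u + (M * q * u - ln (1 + M * q * u)) / M ^+ 2) phi
  (fun u => phi1 0 + phi2 0 * u / (1 + M * q * u)) phi1 0 t t0.
rewrite !mulr0 addr0 ln1 subrr mul0r addr0 subr0; apply => u /andP[u0 _]; last first.
  by rewrite -lerBrDl; exact: self_concordant_ge1.
have p0 : 0 < 1 + M * q * u.
  by rewrite ltr_wpDr//; apply: mulr_ge0 => //; apply: mulr_ge0; exact: ltW.
apply: is_derive_add.
  exact: dlin.
have -> : phi2 0 = (M * q / M) ^+ 2 by rewrite mulrAC divff ?gt_eqF// mul1r q2.
exact: dlog.
Qed.

Lemma self_concordant_le t : 0 <= t -> M * q * t < 1 ->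
  phi t - phi 0 <= phi1 0 * t + (- (M * q * t) - ln (1 - M * q * t)) / M ^+ 2.
Proof.
move=> t0 Mqt.
have p0 u : 0 <= u <= t -> 0 < 1 - M * q * u.
  move=> /andP[u0 ut]; rewrite subr_gt0; apply: le_lt_trans Mqt.
  by rewrite ler_wpM2l//; apply: mulr_ge0; exact: ltW.
have := @ler_derive R phi
  (fun u => phi1 0 * u + (- (M * q) * u - ln (1 + (- (M * q)) * u)) / M ^+ 2)
  phi1 (fun u => phi1 0 + phi2 0 * u / (1 + (- (M * q)) * u)) 0 t t0.
rewrite !mulr0 addr0 ln1 subrr mul0r addr0 subr0 !mulNr.
apply => u ut.
- apply: is_derive_add.
    exact: dlin.
  have -> : phi2 0 = (- (M * q) / M) ^+ 2.
    by rewrite mulNr sqrrN mulrAC divff ?gt_eqF// mul1r q2.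
  by apply: dlog; rewrite mulNr p0.
- rewrite mulNr -lerBlDl; apply: self_concordant_le1; first by case/andP: ut.
  by have := p0 u ut; rewrite subr_gt0.
Qed.

End SelfConcordantLine.

(** * Inequalities between [ln], [expR] and rational functions *)

Section ScalarInequalities.
Context {R : realType}.
Implicit Types s t u v z : R.

Lemma ler_derive_ge0 (F F' : R -> R) a b : a <= b ->
  (forall t, a <= t <= b -> is_derive t 1 F (F' t)) ->
  (forall t, a <= t <= b -> 0 <= F' t) -> F a <= F b.
Proof.
move=> ab dF F'0; rewrite -subr_ge0.
have := @ler_derive R (fun _ => 0) F (fun _ => 0) F' a b ab.
by rewrite subrr; apply => t tab; exact: F'0.
Qed.

(** Both sides agree at 1, and the derivative of their difference is the square of [1 - u^-1]. *)
Lemma two_ln_le v : 1 <= v -> 2 * ln v <= v - v^-1.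
Proof.
move=> v1.
have := @ler_derive_ge0 (fun u => (u - u^-1) - 2 * ln u)
  (fun u => (1 - - u ^- 2 * 1) - 2 * (u^-1 * 1)) 1 v v1.
rewrite invr1 ln1 mulr0 !subrr subr_ge0; apply=> u /andP[u1 _]; have u0 : 0 < u by lra.
  apply: is_derive_sub.
    by apply: is_derive_sub; apply: is_derive_inv; rewrite gt_eqF.
  by apply: is_derive_mull; exact: is_derive_ln.
have -> : 1 - - u ^- 2 * 1 - 2 * (u^-1 * 1) = (1 - u^-1) ^+ 2.
  by field; rewrite gt_eqF.
exact: sqr_ge0.
Qed.

(** The standard function of self-concordance theory: with [z = M eta], a damped Newton step
    decreases [f] by at least [omega z / M ^+ 2]. *)
Definition omega z := z - ln (1 + z).

Lemma omega_ge z : 0 <= z -> z ^+ 2 / (2 * (1 + z)) <= omega z.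
Proof.
move=> z0; have /two_ln_le : 1 <= 1 + z by lra.
have -> : z ^+ 2 / (2 * (1 + z)) = z - (1 + z - (1 + z)^-1) / 2.
  by field; rewrite gt_eqF//; lra.
rewrite /omega; lra.
Qed.

(** For [v = (1 + z) alpha] this expression is exactly the amount by which the decrease guaranteed
    in the second branch of the step size exceeds [omega z]. *)
Lemma ln_quadratic_ge v : 1 <= v -> 0 <= 1 - v + ln v + (v - 1) ^+ 2 / 2.
Proof.
move=> v1.
have := @ler_derive_ge0 (fun u => ln u + u * (u * 2^-1 - 2))
  (fun u => u^-1 * 1 + (u * (2^-1 - 0) + (u * 2^-1 - 2) * 1)) 1 v v1.
rewrite ln1 => h; suff : 0 + 1 * (1 / 2 - 2) <= ln v + v * (v / 2 - 2) by lra.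
apply: h => u /andP[u1 _]; have u0 : 0 < u by lra.
  apply: is_derive_add.
    exact: is_derive_ln.
  apply: is_derive_mul; apply: is_derive_sub.
  have -> : (fun v : R => v / 2) = (fun v => 2^-1 * v).
    by apply/funext => ?; rewrite mulrC.
  by rewrite -[X in is_derive _ _ _ X]mulr1; apply: is_derive_mull.
have -> : u^-1 * 1 + (u * (2^-1 - 0) + (u * 2^-1 - 2) * 1) = u^-1 * (u - 1) ^+ 2.
  by field; rewrite gt_eqF.
by rewrite mulr_ge0 ?sqr_ge0// invr_ge0 ltW.
Qed.

Lemma expR_ge_quadratic s : 0 <= s -> 1 + s + s ^+ 2 / 2 <= expR s.
Proof.
move=> s0.
have := @ler_derive_ge0 (fun u => expR u - (u + u * u * 2^-1))
  (fun u => expR u - (1 + (u * u * 0 + 2^-1 * (u * 1 + u * 1)))) 0 s s0.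
rewrite expR0 => h; suff : 1 - (0 + 0 * 0 / 2) <= expR s - (s + s * s / 2) by lra.
apply: h => u /andP[u0 _].
  by apply: is_derive_sub; apply: is_derive_add; apply: is_derive_mul.
by have := expR_ge1Dx u; lra.
Qed.

(** An inversion of [omega]. At [y = s + s^2/2] one has [1 + y <= exp s], so [omega y >= s^2/2]; the
    tangent of [ln] at [1 + y] shows that [omega] is larger still beyond [y]. The conclusion amounts
    to [1 + 2 z <= (1 + s)^2], the source of the shape of [Gamma]. *)
Lemma omega_le z s : 0 <= z -> 0 < s -> omega z <= s ^+ 2 / 2 ->
  z <= s + s ^+ 2 / 2.
Proof.
move=> z0 s0; set y := s + _ => oz.
have s2 : 0 < s ^+ 2 by rewrite exprn_gt0.
have y0 : 0 < y by rewrite /y; lra.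
have lny : ln (1 + y) <= s.
  by rewrite -ler_expR lnK ?posrE; [rewrite /y addrA; exact/expR_ge_quadratic/ltW|lra].
have : ln (1 + z) <= ln (1 + y) + (z - y) / (1 + y).
  rewrite -lerBlDl -ln_div ?posrE; [|lra|lra].
  have -> : (1 + z) / (1 + y) = 1 + (z - y) / (1 + y) by field; rewrite gt_eqF//; lra.
  apply: le_ln1Dx; rewrite ltr_pdivlMr; lra.
move=> lnz; rewrite leNgt; apply/negP => yz.
have : (z - y) * (1 + y)^-1 < z - y.
  by rewrite gtr_pMr ?invf_lt1; lra.
by move: oz; rewrite /omega /y in yz lny lnz *; lra.
Qed.

End ScalarInequalities.

(** * The adaptive step size *)

Section QuadraticUpperBound.
Context {R : realType}.

Lemma quadratic_upper_bound (phi phi1 phi2 : R -> R) (K a b : R) : a <= b ->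
  (forall t : R, is_derive t 1 phi (phi1 t)) ->
  (forall t : R, is_derive t 1 phi1 (phi2 t)) ->
  (forall t, a <= t <= b -> phi2 t <= K) ->
  phi b - phi a <= phi1 a * (b - a) + K / 2 * (b - a) ^+ 2.
Proof.
move=> ab dphi dphi1 phi2_le.
have lin (c t : R) : is_derive t 1 (fun u => c * u) c.
  by rewrite -[X in is_derive _ _ _ X]mulr1; apply: is_derive_mull.
have phi1_le t : a <= t <= b -> phi1 t <= phi1 a + K * (t - a).
  move=> /andP[at_ tb].
  have := @ler_derive R phi1 (fun u => K * u) phi2 (fun _ => K) a t at_.
  rewrite -mulrBr lerBlDl; apply => u /andP[au ut]; apply: phi2_le.
  by rewrite au (le_trans ut tb).
have := @ler_derive R phi
  (fun u => (phi1 a - K * a) * u + K / 2 * (u * u)) phi1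
  (fun u => (phi1 a - K * a) + K / 2 * (u * 1 + u * 1)) a b ab.
have -> : phi1 a * (b - a) + K / 2 * (b - a) ^+ 2 =
  (phi1 a - K * a) * b + K / 2 * (b * b) - ((phi1 a - K * a) * a + K / 2 * (a * a)).
  by field.
apply=> u uab.
by apply: le_trans (phi1_le _ uab) _; lra.
Qed.

End QuadraticUpperBound.

Section AdaptiveStep.
Context {R : realType}.

(* With [z = M eta] this is [M t ||d||_x] for the step size [t] of the paper. *)
Definition scaled_step (z alpha : R) :=
  if (1 + z) * alpha <= 1 then z / (1 + z)
  else z * alpha ^+ 2 + (1 - alpha) ^+ 2.

Variables (z alpha : R).
Hypothesis z_gt0 : 0 < z.
Hypothesis alpha_gt0 : 0 < alpha.
Hypothesis alpha_le1 : alpha <= 1.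

Local Notation w := (scaled_step z alpha).

(** The left side is the damped Newton step, which the adaptive step never undercuts. *)
Lemma scaled_step_ge : z / (1 + z) <= w.
Proof.
have z0 := z_gt0; rewrite /scaled_step; case: ifP => // _.
have z1 : 0 < 1 + z by lra.
rewrite -subr_ge0.
have -> : z * alpha ^+ 2 + (1 - alpha) ^+ 2 - z / (1 + z) =
  ((1 + z) * alpha - 1) ^+ 2 / (1 + z) by field; rewrite gt_eqF.
by rewrite divr_ge0 ?sqr_ge0// ltW.
Qed.

Lemma scaled_step_gt0 : 0 < w.
Proof.
by have z0 := z_gt0; apply: lt_le_trans scaled_step_ge; rewrite divr_gt0//; lra.
Qed.

(** In unscaled form the left side is [- g^T d / (L ||d||^2)], the minimizer of the quadratic upper
    bound with curvature [L]; the adaptive step is at least as long. *)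
Lemma scaled_step_ge_sqr : z * alpha ^+ 2 <= w.
Proof.
have z0 := z_gt0; have a0 := alpha_gt0; have a1 := alpha_le1.
rewrite /scaled_step; case: ifP => [h|_]; last by rewrite lerDl sqr_ge0.
rewrite ler_pM2l// -[leRHS]div1r ler_pdivlMr; last lra.
by rewrite mulrC (le_trans _ h)// ler_wpM2l; [|lra|nra].
Qed.

Variables (M q : R) (phi phi1 phi2 phi3 : R -> R).
Hypothesis M_gt0 : 0 < M.
Hypothesis dphi : forall t : R, is_derive t 1 phi (phi1 t).
Hypothesis dphi1 : forall t : R, is_derive t 1 phi1 (phi2 t).
Hypothesis dphi2 : forall t : R, is_derive t 1 phi2 (phi3 t).
Hypothesis phi2_gt0 : forall t, 0 < phi2 t.
Hypothesis phi3_le : forall t, `|phi3 t| <= 2 * M * Num.sqrt (phi2 t) ^+ 3.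
Hypothesis q_gt0 : 0 < q.
Hypothesis q2 : q ^+ 2 = phi2 0.
Hypothesis phi1_0 : phi1 0 = - (z / M * q).
Hypothesis phi2_le : forall t, phi2 t <= q ^+ 2 / alpha ^+ 2.

Local Notation t := (w / (M * q)).

Let Mq_gt0 : 0 < M * q. Proof. exact: mulr_gt0. Qed.

(** The second derivative has two upper bounds, [q^2 / (1 - M q u)^2] by self-concordance and
    [q^2 / alpha^2] by smoothness, which cross at [M q u = 1 - alpha]. The test [(1 + z) alpha <= 1]
    says that the damped Newton step ends before the crossing. Otherwise the step continues from the
    crossing to the minimizer of the quadratic bound. *)
Lemma step_decrease :
  omega z <= M ^+ 2 * (phi 0 - phi t) /\ z * w / 2 <= M ^+ 2 * (phi 0 - phi t).
Proof.
have z0 := z_gt0; have al0 := alpha_gt0; have al1 := alpha_le1.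
have M2 : 0 < M ^+ 2 by rewrite exprn_gt0.
have z1 : 0 < 1 + z by lra.
have Mqt c : M * q * (c / (M * q)) = c by field; rewrite !gt_eqF.
have oz := omega_ge (ltW z_gt0).
rewrite /scaled_step; case: ifPn => [h|].
  have c0 : 0 <= z / (1 + z) by rewrite divr_ge0// ltW.
  have t0 : 0 <= z / (1 + z) / (M * q) by rewrite divr_ge0// ltW.
  have := self_concordant_le M_gt0 dphi dphi1 dphi2 phi2_gt0 phi3_le q_gt0 q2 t0.
  have e1 : 1 - z / (1 + z) = (1 + z)^-1 by field; rewrite gt_eqF.
  rewrite Mqt phi1_0 e1 lnV ?posrE// ltr_pdivrMr// => /(_ _) dec.
  have {}dec := ler_wpM2l (ltW M2) (dec _).
  have {dec} := dec ltac:(lra).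
  have -> : M ^+ 2 * (- (z / M * q) * (z / (1 + z) / (M * q)) +
     (- (z / (1 + z)) - - ln (1 + z)) / M ^+ 2) = - omega z.
    by rewrite /omega; field; rewrite !gt_eqF.
  move=> dec; split; first lra.
  apply: le_trans (_ : omega z <= _); last lra.
  by move: oz; rewrite invfM expr2; lra.
rewrite -ltNge => h; set v := z * _ + _.
have a0 : 0 <= 1 - alpha by lra.
have y0 : 0 <= z - (1 - alpha) / alpha.
  rewrite subr_ge0 ler_pdivrMr//; lra.
have v1 : v - (1 - alpha) = alpha ^+ 2 * (z - (1 - alpha) / alpha).
  by rewrite /v; field; rewrite gt_eqF.
(* The crossing point of the two bounds: self-concordance is used up to [t1] and the quadratic bound
   from there to the end of the step. *)
pose t1 := (1 - alpha) / (M * q).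
have t10 : 0 <= t1 by rewrite divr_ge0// ltW.
have := self_concordant_le1 M_gt0 dphi1 dphi2 phi2_gt0 phi3_le q_gt0 q2 t10.
have := self_concordant_le M_gt0 dphi dphi1 dphi2 phi2_gt0 phi3_le q_gt0 q2 t10.
rewrite /t1 Mqt.
have -> : 1 - (1 - alpha) = alpha by ring.
have alpha1 : 1 - alpha < 1 by lra.
move=> /(_ alpha1) d0 /(_ alpha1) d1.
have t1t : t1 <= v / (M * q) by rewrite ler_pM2r ?invr_gt0// -subr_ge0 v1 mulr_ge0// sqr_ge0.
have d2 := quadratic_upper_bound t1t dphi dphi1 (fun u _ => phi2_le u).
have {d0} := ler_wpM2l (ltW M2) d0.
have {d2} := ler_wpM2l (ltW M2) d2.
rewrite /t1 -mulrBl v1 -/t1 => d2.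
have {d1} d1 : phi1 t1 <= - (q / M) * (z - (1 - alpha) / alpha).
  move: d1; rewrite phi1_0 -q2 -/t1 => d1.
  have E : - (q / M) * (z - (1 - alpha) / alpha) =
    q ^+ 2 * ((1 - alpha) / (M * q)) / alpha - z / M * q by field; rewrite !gt_eqF.
  by rewrite E; rewrite /t1 in d1 *; lra.
(* [q / M * y] is the descent slope still guaranteed at [t1], and [alpha^2 y] the scaled length of
   the second piece, which contributes [alpha^2 y^2 / 2] to the decrease. *)
set y := z - _ in y0 v1 d1 d2 *.
have {d1} := ler_wpM2l (mulr_ge0 (ltW M2) (divr_ge0 (mulr_ge0 (sqr_ge0 alpha) y0) (ltW Mq_gt0))) d1.
have -> : M ^+ 2 * (alpha ^+ 2 * y / (M * q)) * (- (q / M) * y) = - (alpha ^+ 2 * y ^+ 2).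
  by field; rewrite !gt_eqF.
move=> d1.
have E2 : M ^+ 2 * (q ^+ 2 / alpha ^+ 2 / 2 * (alpha ^+ 2 * y / (M * q)) ^+ 2)
   = alpha ^+ 2 * y ^+ 2 / 2 by field; rewrite !gt_eqF.
move: d2; rewrite [leRHS]mulrDr E2 => d2.
have E3 : M ^+ 2 * (phi1 0 * ((1 - alpha) / (M * q)) +
    (- (1 - alpha) - ln alpha) / M ^+ 2) = - ((1 + z) * (1 - alpha) + ln alpha).
  by rewrite phi1_0; field; rewrite !gt_eqF.
rewrite E3 -/t1 => d0.
have {d0 d1 d2} dec : (1 + z) * (1 - alpha) + ln alpha + alpha ^+ 2 * y ^+ 2 / 2
   <= M ^+ 2 * (phi 0 - phi (v / (M * q))) by lra.
have ay : alpha ^+ 2 * y ^+ 2 = ((1 + z) * alpha - 1) ^+ 2.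
  by rewrite /y; field; rewrite gt_eqF.
split; apply: le_trans dec; rewrite ay.
  have := ln_quadratic_ge (ltW h).
  by rewrite lnM ?posrE// /omega; lra.
(* Once the terms quadratic in [z] cancel, what remains grows with [z]. At the least admissible
   value [z = alpha^-1 - 1], with this bound for the logarithm, it is exactly 0. *)
have : 2 * ln alpha^-1 <= alpha^-1 - alpha.
  by have := @two_ln_le R alpha^-1; rewrite invrK invf_ge1//; apply.
rewrite lnV ?posrE// => la.
have : (alpha^-1 - 1) * (1 - alpha) ^+ 2 <= z * (1 - alpha) ^+ 2.
  rewrite ler_wpM2r ?sqr_ge0//.
  by move: y0; rewrite /y mulrBl divff ?gt_eqF// mul1r; lra.
have -> : (alpha^-1 - 1) * (1 - alpha) ^+ 2 = alpha^-1 - 3 + 3 * alpha - alpha ^+ 2.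
  by field; rewrite gt_eqF.
rewrite /v; nra.
Qed.

Lemma step_curvature_ge : q / M * (w / (1 + w)) <= phi1 t - phi1 0.
Proof.
have w0 := scaled_step_gt0.
have t0 : 0 <= t by rewrite divr_ge0// ltW.
have := self_concordant_ge1 M_gt0 dphi1 dphi2 phi2_gt0 phi3_le q_gt0 q2 t0.
congr (_ <= _); rewrite -q2.
have -> : M * q * (w / (M * q)) = w by field; rewrite !gt_eqF.
field; rewrite !gt_eqF//; lra.
Qed.

End AdaptiveStep.

(** * Positive definite matrices *)

Section DotProduct.
Context {R : realType}.
Implicit Types n : nat.

Lemma dotC n (u v : 'cV[R]_n) : dot u v = dot v u.
Proof. by rewrite /dot -[in LHS](trmxK v) -trmx_mul mxE. Qed.

Lemma dotDl n (u v w : 'cV[R]_n) : dot (u + v) w = dot u w + dot v w.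
Proof. by rewrite /dot linearD mulmxDl mxE. Qed.

Lemma dotZl n (a : R) (u v : 'cV[R]_n) : dot (a *: u) v = a * dot u v.
Proof. by rewrite /dot linearZ -scalemxAl mxE. Qed.

Lemma dotNl n (u v : 'cV[R]_n) : dot (- u) v = - dot u v.
Proof. by rewrite -scaleN1r dotZl mulN1r. Qed.

Lemma dotBl n (u v w : 'cV[R]_n) : dot (u - v) w = dot u w - dot v w.
Proof. by rewrite dotDl dotNl. Qed.

Lemma dotDr n (u v w : 'cV[R]_n) : dot w (u + v) = dot w u + dot w v.
Proof. by rewrite dotC dotDl !(dotC w). Qed.

Lemma dotZr n (a : R) (u v : 'cV[R]_n) : dot u (a *: v) = a * dot u v.
Proof. by rewrite dotC dotZl dotC. Qed.

Lemma dotNr n (u v : 'cV[R]_n) : dot u (- v) = - dot u v.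
Proof. by rewrite dotC dotNl dotC. Qed.

Lemma dotBr n (u v w : 'cV[R]_n) : dot w (u - v) = dot w u - dot w v.
Proof. by rewrite dotDr dotNr. Qed.

Lemma dot0l n (u : 'cV[R]_n) : dot 0 u = 0.
Proof. by rewrite -(scale0r 0) dotZl mul0r. Qed.

Lemma dot0r n (u : 'cV[R]_n) : dot u 0 = 0.
Proof. by rewrite dotC dot0l. Qed.

Lemma dotE n (u v : 'cV[R]_n) : dot u v = \sum_i u i 0 * v i 0.
Proof. by rewrite /dot mxE; apply: eq_bigr => i _; rewrite mxE. Qed.

Lemma dot_mulmx m n (A : 'M[R]_(m, n)) u v : dot u (A *m v) = dot (A^T *m u) v.
Proof. by rewrite /dot trmx_mul trmxK mulmxA. Qed.

Lemma mul_trmx_dot n (u v : 'cV[R]_n) : u^T *m v = (dot u v)%:M.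
Proof. exact: mx11_scalar. Qed.

Lemma mxtrace_mul_trmx n (u v : 'cV[R]_n) : \tr (u *m v^T) = dot v u.
Proof. by rewrite mxtrace_mulC mul_trmx_dot mxtrace_scalar. Qed.

Lemma dot_ge0 n (u : 'cV[R]_n) : 0 <= dot u u.
Proof. by rewrite dotE; apply: sumr_ge0 => i _; rewrite -expr2 sqr_ge0. Qed.

Lemma dot_gt0 n (u : 'cV[R]_n) : (0 < dot u u) = (u != 0).
Proof.
rewrite lt0r dot_ge0 andbT; congr (~~ _); apply/eqP/eqP => [|->]; last exact: dot0l.
rewrite dotE => /eqP; rewrite psumr_eq0 => [/allP u0|i _]; last by rewrite -expr2 sqr_ge0.
apply/matrixP => i j; rewrite ord1 mxE.
by have /eqP/eqP := u0 i (mem_index_enum _); rewrite mulf_eq0 orbb => /eqP.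
Qed.

Lemma enorm_sqr n (u : 'cV[R]_n) : enorm u ^+ 2 = dot u u.
Proof. by rewrite sqr_sqrtr// dot_ge0. Qed.

Lemma enorm_ge0 n (u : 'cV[R]_n) : 0 <= enorm u.
Proof. exact: sqrtr_ge0. Qed.

Lemma enorm_gt0 n (u : 'cV[R]_n) : (0 < enorm u) = (u != 0).
Proof. by rewrite sqrtr_gt0 dot_gt0. Qed.

Lemma enormZ n (a : R) (u : 'cV[R]_n) : enorm (a *: u) = `|a| * enorm u.
Proof. by rewrite /enorm dotZl dotZr mulrA -expr2 sqrtrM ?sqr_ge0// sqrtr_sqr. Qed.

Lemma dot_col_mx m n (a c : 'cV[R]_m) (b d : 'cV[R]_n) :
  dot (col_mx a b) (col_mx c d) = dot a c + dot b d.
Proof. by rewrite /dot tr_col_mx mul_row_col mxE. Qed.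

(* The discriminant of the nonnegative quadratic t |-> (u + t v)^T A (u + t v)
   is nonpositive. *)
Lemma psd_cauchy_schwarz n (A : 'M[R]_n) (u v : 'cV[R]_n) : A^T = A ->
  (forall w, 0 <= dot w (A *m w)) ->
  dot u (A *m v) ^+ 2 <= dot u (A *m u) * dot v (A *m v).
Proof.
move=> Asym A0.
have Auv : dot v (A *m u) = dot u (A *m v) by rewrite dot_mulmx Asym dotC.
have quad a b : 0 <= a ^+ 2 * dot u (A *m u) + 2 * a * b * dot u (A *m v)
                     + b ^+ 2 * dot v (A *m v).
  have := A0 (a *: u + b *: v).
  rewrite mulmxDr -!scalemxAr !(dotDl, dotDr, dotZl, dotZr) Auv.
  by congr (_ <= _); ring.
set p := dot u (A *m u) in quad *; set c := dot u (A *m v) in quad *.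
set r := dot v (A *m v) in quad *.
have p0 : 0 <= p := A0 u; have r0 : 0 <= r := A0 v.
have [r00|rn0] := eqVneq r 0.
  (* The second coefficient is chosen so that the quadratic takes the value [- c^2]. *)
  rewrite r00 mulr0; have := quad c (- (p + 1) / 2).
  rewrite r00 mulr0 addr0.
  have -> : c ^+ 2 * p + 2 * c * (- (p + 1) / 2) * c = - c ^+ 2 by field.
  by rewrite oppr_ge0.
have := quad r (- c).
have -> : r ^+ 2 * p + 2 * r * - c * c + (- c) ^+ 2 * r = r * (p * r - c ^+ 2).
  by ring.
by rewrite pmulr_rge0 ?subr_ge0// lt0r rn0.
Qed.

Lemma cauchy_schwarz n (u v : 'cV[R]_n) : `|dot u v| <= enorm u * enorm v.
Proof.
rewrite -(@ler_pXn2r _ 2)// ?nnegrE ?mulr_ge0 ?enorm_ge0//.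
rewrite real_normK ?num_real// exprMn !enorm_sqr.
have := @psd_cauchy_schwarz n 1%:M u v (trmx1 _ _).
by rewrite !mul1mx; apply => w; rewrite mul1mx dot_ge0.
Qed.

End DotProduct.

Section PosDef.
Context {R : realType}.
Implicit Types n : nat.

Lemma posdefmx_ge0 n (A : 'M[R]_n) v : posdefmx A -> 0 <= dot v (A *m v).
Proof.
case=> _ A0; have [->|v0] := eqVneq v 0; first by rewrite dot0l.
exact/ltW/A0.
Qed.

(** The matrix determinant lemma: both block products below equal the matrix with rows [(1, - u)]
    and [(v^T, 1)]. *)
Lemma det_1D_mul_trmx n (u v : 'cV[R]_n) :
  \det (1%:M + u *m v^T) = 1 + dot v u.
Proof.
have := @det_mulmx R (n + 1)
  (block_mx 1%:M (- u) 0 1%:M) (block_mx (1%:M + u *m v^T) 0 v^T 1%:M).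
rewrite mulmx_block det_ublock det_lblock !det1 !mul1r mulr1 => <-.
have := @det_mulmx R (n + 1)
  (block_mx 1%:M 0 v^T (1 + dot v u)%:M) (block_mx 1%:M (- u) 0 1%:M).
rewrite mulmx_block det_ublock det_lblock !det1 !mul1r mulr1 det_scalar1 => <-.
rewrite !mul1mx !mulmx1 !mul0mx !mulmx0 !addr0 !add0r mulNmx addrK.
by rewrite mulmxN mul_trmx_dot raddfD /= addrCA addNr addr0.
Qed.

(** Induction through the Schur complement [S] of the corner entry [a]: [det A = a det S], the trace
    of [S] is at most that of the remaining block, and [ln a <= a - 1]. Positivity of the
    determinant is carried along since the logarithm of the product needs it. *)
Lemma posdefmx_det_trace n (A : 'M[R]_n) :
  posdefmx A -> 0 < \det A /\ ln (\det A) <= \tr A - n%:R.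
Proof.
elim: n A => [|n IHn] A [Asym A0].
  by rewrite det_mx00 ln1 /mxtrace big_ord0 subr0; split.
have {A0} : forall v : 'cV[R]_(1 + n), v != 0 -> 0 < dot v (A *m v) := A0.
have -> : \tr A = \tr (A : 'M_(1 + n)) by [].
have -> : \det A = \det (A : 'M_(1 + n)) by [].
have {Asym} : (A : 'M_(1 + n))^T = A by [].
move: (A : 'M_(1 + n)) => {A} A Asym A0.
pose a := A 0 0; pose b := dlsubmx A; pose C := drsubmx A.
have Aul : ulsubmx A = a%:M.
  by rewrite [LHS]mx11_scalar; congr _%:M; rewrite !mxE; congr (A _ _); apply/val_inj.
have Aur : ursubmx A = b^T by rewrite /b trmx_dlsub Asym.
have Csym : C^T = C by rewrite /C trmx_drsub Asym.
have AE : A = block_mx a%:M b^T b C by rewrite -Aul -Aur submxK.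
have dot11 (c d : R) : dot (c%:M : 'cV_1) d%:M = c * d.
  by rewrite dotE big_ord1 !mxE !mulr1n.
have quad (c : R) v : dot (col_mx (c%:M : 'cV_1) v) (A *m col_mx c%:M v) =
    a * c ^+ 2 + 2 * c * dot b v + dot v (C *m v).
  rewrite AE mul_block_col dot_col_mx mul_trmx_dot -scalar_mxM -raddfD /= dot11.
  by rewrite mul_mx_scalar dotDr dotZr (dotC v b); ring.
have a0 : 0 < a.
  have := A0 (col_mx 1%:M 0); rewrite quad mulmx0 !dot0r mulr0 !addr0 expr1n mulr1.
  apply; apply/eqP => /matrixP /(_ (lshift _ 0) 0).
  by rewrite col_mxEu !mxE => /eqP; rewrite oner_eq0.
pose S := C - a^-1 *: (b *m b^T).
have detA : \det A = a * \det S.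
  have := det_mulmx (block_mx 1%:M 0 (a^-1 *: b) 1%:M) (block_mx a%:M b^T 0 S).
  rewrite mulmx_block det_lblock det_ublock !det1 !mul1r det_scalar1 => <-.
  rewrite AE !mul1mx !mul0mx !addr0 mul_mx_scalar scalerA divff ?gt_eqF//.
  by rewrite scale1r -scalemxAl /S subrKC.
have posS : posdefmx S.
  split; first by rewrite /S linearB linearZ /= trmx_mul trmxK Csym.
  (* This first coordinate minimizes the quadratic form of [A] for fixed [v], and the minimum is
     [v^T S v]. *)
  move=> v v0; have := A0 (col_mx (- (a^-1 * dot b v))%:M v).
  rewrite quad /S mulmxBl dotBr -scalemxAl dotZr -mulmxA mul_trmx_dot.
  rewrite mul_mx_scalar dotZr (dotC v b) => h.
  suff -> : dot v (C *m v) - a^-1 * (dot b v * dot b v) =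
    a * (- (a^-1 * dot b v)) ^+ 2 + 2 * - (a^-1 * dot b v) * dot b v + dot v (C *m v).
    by apply: h; apply: contra v0 => /eqP; rewrite -col_mx0 => /eq_col_mx[_ ->].
  by field; rewrite gt_eqF.
have [detS lnS] := IHn _ posS; rewrite detA; split; first exact: mulr_gt0.
rewrite lnM ?posrE//.
have := @le_ln1Dx _ (a - 1); rewrite subrKC => lna.
have {}lna : ln a <= a - 1 by apply: lna; lra.
have -> : \tr A = a + \tr C by rewrite AE mxtrace_block mxtrace_scalar.
have trS : \tr S = \tr C - a^-1 * dot b b.
  by rewrite /S linearB linearZ /= mxtrace_mul_trmx.
have : 0 <= a^-1 * dot b b by rewrite mulr_ge0 ?dot_ge0// invr_ge0 ltW.
rewrite trS in lnS; rewrite -natr1; lra.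
Qed.

Lemma posdefmx_det_gt0 n (A : 'M[R]_n) : posdefmx A -> 0 < \det A.
Proof. by case/posdefmx_det_trace. Qed.

Lemma Psi_ge0 n (A : 'M[R]_n) : posdefmx A -> 0 <= Psi A.
Proof. by case/posdefmx_det_trace => _; rewrite /Psi; lra. Qed.

Lemma posdefmx_unit n (A : 'M[R]_n) : posdefmx A -> A \in unitmx.
Proof. by move=> /posdefmx_det_gt0 dA; rewrite unitmxE unitfE gt_eqF. Qed.

Lemma posdefmx_congr n (E A : 'M[R]_n) :
  E \in unitmx -> posdefmx A -> posdefmx (E *m A *m E^T).
Proof.
move=> Eu [Asym A0]; split; first by rewrite !trmx_mul trmxK Asym mulmxA.
move=> v v0; rewrite -!mulmxA dot_mulmx; apply: A0.
apply: contra v0 => /eqP Ev; apply/eqP.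
by rewrite -[v](@mulKmx _ _ _ (E^T)) ?unitmx_tr// Ev mulmx0.
Qed.

Lemma posdefmx_inv n (A : 'M[R]_n) : posdefmx A -> posdefmx (invmx A).
Proof.
move=> pA; have Au := posdefmx_unit pA.
have -> : invmx A = invmx A *m A *m (invmx A)^T.
  by rewrite mulVmx// mul1mx trmx_inv; case: pA => ->.
by apply: posdefmx_congr; rewrite ?unitmx_inv.
Qed.

End PosDef.

(** * The BFGS update *)

Section BfgsUpdate.
Context {R : realType} {n : nat}.
Variables (B : 'M[R]_n) (s y : 'cV[R]_n).
Hypothesis B_posdef : posdefmx B.
Hypothesis curvature : 0 < dot y s.

Let a := dot s (B *m s).
Let b := dot y s.
Let c := Num.sqrt (b / a).

Let s_neq0 : s != 0.
Proof. by apply: contraTneq curvature => ->; rewrite dot0r ltxx. Qed.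

Let a_gt0 : 0 < a. Proof. by case: B_posdef => _; apply. Qed.

Let c_gt0 : 0 < c. Proof. by rewrite sqrtr_gt0 divr_gt0. Qed.

Let c2 : c ^+ 2 = b / a.
Proof. by rewrite sqr_sqrtr// divr_ge0// ltW// curvature. Qed.

(** With this choice [E] sends [B s] to [c^-1 y], and [E^T] multiplies [s] by [c] because
    [c^2 a = b]. Hence [E B E^T] satisfies the secant equation. *)
Let e := (c * a)^-1 *: (y - c *: (B *m s)).
Let E := 1%:M + e *m s^T.

(* The product form of the BFGS update, from which both the positivity and the
   determinant of the updated matrix are read off. *)
Let bfgs_updateE : bfgs_update B s y = E *m B *m E^T.
Proof.
have [Bsym _] := B_posdef.
have a0 : a != 0 by rewrite gt_eqF. have c0 : c != 0 by rewrite gt_eqF.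
have b0 : b != 0 by rewrite gt_eqF// curvature.
have sB : s^T *m B = (B *m s)^T by rewrite trmx_mul Bsym.
set u := B *m s in sB *.
have EB : E *m B = B + e *m u^T by rewrite mulmxDl mul1mx -mulmxA sB.
have ET : E^T = 1%:M + s *m e^T by rewrite linearD /= trmx1 trmx_mul trmxK.
rewrite EB ET mulmxDr mulmx1 mulmxDl -(mulmxA e) (mulmxA u^T) mul_trmx_dot.
rewrite (mulmxA B) -/u (dotC u) -/a mul_scalar_mx -scalemxAr.
rewrite /bfgs_update -/u -/a -/b -(mulmxA u) sB.
have bE : b = c ^+ 2 * a by rewrite c2 divfK.
apply/matrixP => i j; rewrite bE /e !mxE !big_ord1 !mxE.
by field; rewrite ?a0 ?c0.
Qed.

Let detE : \det E = c.
Proof.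
rewrite det_1D_mul_trmx /e dotZr dotBr dotZr -/a (dotC s y) -/b.
have -> : b = c ^+ 2 * a by rewrite c2 divfK// gt_eqF.
by field; rewrite !gt_eqF.
Qed.

Lemma bfgs_update_posdef : posdefmx (bfgs_update B s y).
Proof.
rewrite bfgs_updateE; apply: posdefmx_congr => //.
by rewrite unitmxE unitfE detE gt_eqF.
Qed.

Lemma det_bfgs_update : \det (bfgs_update B s y) = \det B * (b / a).
Proof. by rewrite bfgs_updateE !det_mulmx det_tr detE -c2; ring. Qed.

(** The two rank-one terms account for the change of the trace. The weight multiplies both
    determinants by the same factor, so it drops out of the logarithmic part. *)
Lemma Psi_bfgs_update (S : 'M[R]_n) : posdefmx S ->
  Psi (S *m bfgs_update B s y *m S) =
  Psi (S *m B *m S) - dot (S *m (B *m s)) (S *m (B *m s)) / a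
    + dot (S *m y) (S *m y) / b - ln (b / a).
Proof.
move=> S_posdef; have [Ssym _] := S_posdef; have [Bsym _] := B_posdef.
have dS := posdefmx_det_gt0 S_posdef; have dB := posdefmx_det_gt0 B_posdef.
have ba0 : 0 < b / a by rewrite divr_gt0.
have detS X : \det (S *m X *m S) = \det X * (\det S * \det S).
  by rewrite !det_mulmx; ring.
have lnS X : 0 < \det X -> ln (\det (S *m X *m S)) = ln (\det X) + ln (\det S * \det S).
  by move=> X0; rewrite detS lnM ?posrE// mulr_gt0.
have trS (v : 'cV[R]_n) : \tr (S *m (v *m v^T) *m S) = dot (S *m v) (S *m v).
  by rewrite -mxtrace_mul_trmx trmx_mul Ssym !mulmxA.
rewrite /Psi !lnS// ?(posdefmx_det_gt0 bfgs_update_posdef)// det_bfgs_update.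
have lnb : ln (\det B * (b / a)) = ln (\det B) + ln (b / a) by apply: lnM; rewrite posrE.
rewrite [in LHS]/bfgs_update mulmxDr mulmxBr mulmxDl mulmxBl mxtraceD raddfB /=.
rewrite -!scalemxAr -!scalemxAl !mxtraceZ trS.
have -> : B *m s *m s^T *m B = (B *m s) *m (B *m s)^T.
  by rewrite trmx_mul Bsym mulmxA.
by rewrite trS -/a -/b lnb; ring.
Qed.

End BfgsUpdate.

(** * Square roots of positive definite matrices *)

Section SquareRoot.

Lemma interpolation_exists (K : fieldType) (s : seq K) (g : K -> K) :
  exists p : {poly K}, forall x, x \in s -> p.[x] = g x.
Proof.
elim: s => [|x s [p ps]]; first by exists 0.
have [xs|xs] := boolP (x \in s).
  by exists p => y; rewrite inE => /predU1P[->|]; exact: ps.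
pose w := \prod_(y <- s) ('X - y%:P).
have w0 : w.[x] != 0 by rewrite -/(root w x) root_prod_XsubC.
exists (p + ((g x - p.[x]) / w.[x])%:P * w) => y.
rewrite inE hornerD hornerM hornerC => /predU1P[->|ys].
  by rewrite divfK// subrKC.
suff -> : w.[y] = 0 by rewrite mulr0 addr0 ps.
by apply/eqP; rewrite -/(root w y) root_prod_XsubC.
Qed.

Lemma trmx_horner_mx (K : fieldType) n (A : 'M[K]_n.+1) p :
  A^T = A -> (horner_mx A p)^T = horner_mx A p.
Proof.
move=> As; elim/poly_ind: p => [|p c ih]; first by rewrite rmorph0 trmx0.
rewrite rmorphD rmorphM /= horner_mx_X horner_mx_C linearD /= tr_scalar_mx.
congr (_ + _); rewrite -mulmxE trmx_mul ih As.
exact/comm_mx_horner/comm_mx_refl.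
Qed.

Local Notation toC := (map_mx (real_complex _)).

Lemma posdefmx_spectral (R : realType) n (A : 'M[R]_n.+1) : posdefmx A ->
  exists (P : 'M[R[i]]_n.+1) (d : 'rV[R]_n.+1),
    [/\ P \in unitmx, forall j, 0 < d 0 j &
      toC A = invmx P *m diag_mx (toC d) *m P].
Proof.
move=> [Asym A0].
have Areal : toC A \is hermsymmx.
  apply/is_hermitianmxP; rewrite expr0 scale1r; apply/matrixP => i j.
  by rewrite !mxE -{1}Asym mxE conj_Creal//; apply/complex_realP; exists (A j i).
have Anormal := hermitian_normalmx Areal.
have /orthomx_spectralP AE := Anormal.
have /mxOverP Dreal := hermitian_spectral_diag_real Areal.
set P := spectralmx _ in AE; set D := spectral_diag _ in AE Dreal.
have Pu : P \in unitmx by exact: spectral_unit.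
pose d : 'rV[R]_n.+1 := map_mx (@complex.Re R) D.
have DE : D = toC d.
  by apply/matrixP => i j; rewrite !mxE RRe_real.
exists P, d; split; [exact: Pu| |by rewrite -DE].
move=> j.
(* The rows of [P] are complex, whereas positivity of [A] concerns real vectors. The characteristic
   polynomial transfers the eigenvalue to the real field, where it has a real eigenvector. *)
have : eigenvalue A (d 0 j).
  rewrite eigenvalue_root_char -(fmorph_root (real_complex R)) map_char_poly.
  rewrite -eigenvalue_root_char; apply/eigenvalueP; exists (row j P).
    rewrite AE -row_mul !mulmxA mulmxV// mul1mx row_mul row_diag_mx DE.
    by rewrite -scalemxAl -rowE; congr (_ *: _); rewrite mxE.
  apply/eqP => Pj0; have := row_mul j P (invmx P).
  rewrite Pj0 mul0mx mulmxV// => /matrixP /(_ 0 j).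
  by rewrite !mxE eqxx => /eqP; rewrite oner_eq0.
move=> /eigenvalueP[v vA v0].
have vT0 : v^T != 0 by rewrite trmx_eq0.
have := A0 _ vT0; rewrite -[A in X in X -> _]Asym -trmx_mul vA linearZ /= dotZr.
by rewrite pmulr_lgt0// dot_gt0.
Qed.

(** The diagonalization is complex but the root must be real. A real polynomial [p] interpolating
    the fourth root at the eigenvalues gives a real symmetric [T = p(A)] with [T^4 = A]. Fourth
    roots are taken so that [T T^T], congruent to the identity, is visibly positive definite. *)
Lemma posdefmx_sqrt_exists (R : realType) n (A : 'M[R]_n) : posdefmx A ->
  exists S, posdefmx S /\ S *m S = A.
Proof.
case: n A => [|n] A pA; first by exists A; split=> //; apply/matrixP => -[].
have [P [d [Pu d0 AE]]] := posdefmx_spectral pA.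
have [p pE] := interpolation_exists [seq d 0 j | j <- enum 'I_n.+1]
  (fun x => Num.sqrt (Num.sqrt x)).
have {pE} p4 j : p.[d 0 j] ^+ 4 = d 0 j.
  rewrite pE; last by rewrite map_f// mem_enum.
  by rewrite (exprM _ 2 2) !sqr_sqrtr ?sqrtr_ge0// ltW.
pose T := horner_mx A p.
have T4 : T ^+ 4 = A.
  rewrite /T -rmorphXn; apply: (@map_mx_inj _ _ (real_complex R)).
  rewrite map_horner_mx AE horner_mx_uconjC// horner_mx_diag.
  congr (_ *m diag_mx _ *m _); apply/matrixP => i j.
  by rewrite ord1 !mxE horner_map /= horner_exp p4.
have Tsym : T^T = T by apply: trmx_horner_mx; case: pA.
have Tu : T \in unitmx.
  by have := posdefmx_unit pA; rewrite -T4 -[_ \in _]/(_ \is a GRing.unit) unitrX_pos.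
exists (T *m 1%:M *m T^T); split.
  apply: posdefmx_congr => //; split; first exact: trmx1.
  by move=> v v0; rewrite mul1mx dot_gt0.
by rewrite mulmx1 Tsym mulmxE -T4 !exprS expr0 mulr1 !mulrA.
Qed.

Lemma sqrtmxP (R : realType) n (A : 'M[R]_n) : posdefmx A ->
  posdefmx (sqrtmx A) /\ sqrtmx A *m sqrtmx A = A.
Proof.
move=> /posdefmx_sqrt_exists [S hS].
by have := @xgetPex _ 0 [set S | posdefmx S /\ S *m S = A]%classic (ex_intro _ S hS).
Qed.

End SquareRoot.

(** * Directional derivatives *)

Section DirectionalDerivatives.
Context {R : realType} {V : normedModType R}.
Implicit Types (g : V -> R) (x u v d : V) (a l t : R).

Lemma is_derive_lineP g x d l :
  is_derive x d g l <-> is_derive (0 : R) 1 (fun t => g (t *: d + x)) l.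
Proof.
have E : (fun h : R => h^-1 *: (((fun t => g (t *: d + x)) \o shift 0) (h *: 1)
    - g ((0 : R) *: d + x))) =
  (fun h => h^-1 *: ((g \o shift x) (h *: d) - g x)).
  by apply/funext => h /=; rewrite scale0r add0r addr0 [h *: 1]mulr1.
split=> -[D <-]; constructor.
- by rewrite /derivable E.
- by rewrite /derive E.
- by move: D; rewrite /derivable E.
- by rewrite [in RHS]/derive E.
Qed.

Lemma is_derive_line g x d t l : is_derive (x + t *: d) d g l ->
  is_derive t 1 (fun s => g (x + s *: d)) l.
Proof.
have E : (fun h : R => h^-1 *: (((fun s => g (x + s *: d)) \o shift t) (h *: 1)
    - g (x + t *: d))) =
  (fun h => h^-1 *: ((g \o shift (x + t *: d)) (h *: d) - g (x + t *: d))).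
  by apply/funext => h /=; rewrite [h *: 1]mulr1 scalerDl addrCA.
move=> -[D <-]; constructor; first by rewrite /derivable E.
by rewrite /derive E.
Qed.

Lemma is_derive_scale_dir g x d a l :
  is_derive x d g l -> is_derive x (a *: d) g (l * a).
Proof.
move=> /is_derive_lineP D; apply/is_derive_lineP.
have -> : (fun t => g (t *: (a *: d) + x)) = (fun t => g (t *: d + x)) \o *%R a.
  by apply/funext => t /=; rewrite scalerA mulrC.
apply: is_derive1_comp; first by rewrite mulr0.
by rewrite -[X in is_derive _ _ _ X]mulr1; apply: is_derive_mull.
Qed.

Lemma MVT01 (F F' : R -> R) : (forall t : R, is_derive t 1 F (F' t)) ->
  exists2 c, 0 <= c <= 1 & F 1 - F 0 = F' c.
Proof.
move=> dF; have [|c] := @MVT_segment R F F' 0 1 ler01 (fun t _ => dF t).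
  by apply: derivable_within_continuous => t _; have [] := dF t.
by rewrite in_itv /= subr0 mulr1 => c01 ->; exists c.
Qed.

Lemma continuous_dist g x : continuous g -> forall e, 0 < e ->
  exists2 r, 0 < r & forall y, `|y - x| < r -> `|g y - g x| < e.
Proof.
move=> /(_ x) /cvgrPdist_lt cg e e0; have /nbhs_ballP[r /= r0 rP] := cg _ e0.
exists r => // y yx; rewrite distrC; apply: (rP y).
by rewrite -ball_normE /= distrC.
Qed.

(** The difference quotient splits at the intermediate point [x + h u]. The second part is a
    derivative along [v] at a nearby point, by the mean value theorem, and continuity of that
    derivative gives its limit. *)
Lemma is_derive_add_dir g u v : (forall x, derivable g x u) ->
  (forall x, derivable g x v) -> continuous ('D_v g) ->
  forall x, is_derive x (u + v) g ('D_u g x + 'D_v g x).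
Proof.
move=> gu gv cv x.
suff h : ((fun h : R => h^-1 *: ((g \o shift x) (h *: (u + v)) - g x)) @ 0^'
    --> ('D_u g x + 'D_v g x)%R)%classic.
  by constructor; [apply/cvg_ex; eexists; exact: h|exact: (cvg_lim _ h)].
have -> : (fun h : R => h^-1 *: ((g \o shift x) (h *: (u + v)) - g x)) =
    (fun h : R => h^-1 *: ((g \o shift x) (h *: u) - g x)) +
    (fun h : R => h^-1 *: (g (h *: u + x + h *: v) - g (h *: u + x))).
  apply/funext => h /=; rewrite fctE -scalerDr; congr (_ *: _).
  by rewrite scalerDr addrAC [RHS]addrC subrKA.
apply: cvgD; first by have := gu x.
apply/cvgrPdist_lt => e e0; have [r r0 rP] := continuous_dist x cv e0.
pose r' := r / (`|u| + `|v| + 1).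
have N0 : 0 < `|u| + `|v| + 1 by rewrite ltr_wpDl// addr_ge0.
have r'0 : 0 < r' by rewrite divr_gt0.
near=> h.
have h0 : h != 0 by near: h; exact: nbhs_dnbhs_neq.
have hr : `|h| < r' by near: h; exact: dnbhs0_lt.
have dl t : is_derive t 1 (fun s => g (h *: u + x + s *: (h *: v)))
    ('D_v g (h *: u + x + t *: (h *: v)) * h).
  exact/is_derive_line/is_derive_scale_dir/derivableP/gv.
have [c /andP[c0 c1]] := MVT01 dl.
rewrite scale1r scale0r addr0 => ->.
have sE (a : R) : h^-1 *: (a * h) = a by rewrite [LHS]mulrC mulfK.
rewrite sE distrC; apply: rP.
rewrite addrAC addrK.
apply: le_lt_trans (ler_normD _ _) _; rewrite !normrZ (ger0_norm c0).
apply: (@le_lt_trans _ _ (`|h| * (`|u| + `|v| + 1))); last by rewrite -ltr_pdivlMr.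
rewrite !mulrDr mulr1 -addrA lerD2l.
apply: (@le_trans _ _ (`|h| * `|v|)); last by rewrite lerDl.
by rewrite ler_piMl// mulr_ge0.
Unshelve. all: by end_near. Qed.

(** The mean value theorem is applied along [u] and then along [v]. Up to order the left side is
    symmetric in [u] and [v], so shrinking [h] identifies the two mixed derivatives. *)
Lemma second_difference g x u v (h : R) : (forall x, derivable g x u) ->
  (forall x, derivable ('D_u g) x v) ->
  exists2 y, `|y - x| <= `|h| * (`|u| + `|v|) &
    g (x + h *: u + h *: v) - g (x + h *: u) - g (x + h *: v) + g x =
    'D_v ('D_u g) y * (h * h).
Proof.
move=> gu guv.
have dl y t : is_derive t 1 (fun s => g (y + s *: (h *: u)))
    ('D_u g (y + t *: (h *: u)) * h).
  exact/is_derive_line/is_derive_scale_dir/derivableP/gu.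
have [c /andP[c0 c1] E] :=
  MVT01 (fun t => is_derive_sub (dl (x + h *: v) t) (dl x t)).
have dl' t : is_derive t 1 (fun s => 'D_u g (x + c *: (h *: u) + s *: (h *: v)))
    ('D_v ('D_u g) (x + c *: (h *: u) + t *: (h *: v)) * h).
  apply: (is_derive_line (g := 'D_u g)).
  exact/is_derive_scale_dir/derivableP/guv.
have [c' /andP[c'0 c'1] E'] := MVT01 dl'.
exists (x + c *: (h *: u) + c' *: (h *: v)).
  rewrite -(addrA x) [X in `|X|]addrC addKr; apply: le_trans (ler_normD _ _) _.
  rewrite !normrZ (ger0_norm c0) (ger0_norm c'0) mulrDr.
  by apply: lerD; rewrite ler_piMl// mulr_ge0.
rewrite mulrA -E' scale1r scale0r addr0 [X in 'D_u g X - _]addrAC.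
move: E; rewrite !scale1r !scale0r !addr0 -mulrBl => <-.
rewrite (addrAC x (h *: v)).
move: (g (x + h *: u + h *: v)) (g (x + h *: u)) (g (x + h *: v)) (g x).
by move=> p1 p2 p3 p4; ring.
Qed.

Lemma eq_by_continuity (F1 F2 : V -> R) x (N : R) : 0 <= N ->
  continuous F1 -> continuous F2 ->
  (forall h, 0 < h -> exists y z,
    [/\ `|y - x| <= h * N, `|z - x| <= h * N & F1 y = F2 z]) ->
  F1 x = F2 x.
Proof.
move=> N0 c1 c2 FF; apply/eqP.
rewrite -subr_eq0 -normr_le0; apply/ler_addgt0Pl => e e0; rewrite addr0.
have e2 : 0 < e / 2 by rewrite divr_gt0.
have [r1 r10 r1P] := continuous_dist x c1 e2.
have [r2 r20 r2P] := continuous_dist x c2 e2.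
pose r := Num.min r1 r2; have r0 : 0 < r by rewrite lt_min r10.
have N1 : 0 < N + 1 by rewrite ltr_wpDl.
have h0 : 0 < r / (N + 1) by rewrite divr_gt0.
have hr : r / (N + 1) * N < r.
  by rewrite mulrAC ltr_pdivrMr// ltr_pM2l// ltrDl.
have [y [z [yx zx E]]] := FF _ h0.
have /r1P h1 : `|y - x| < r1.
  by rewrite (le_lt_trans yx)// (lt_le_trans hr)// ge_min lexx.
have /r2P h2 : `|z - x| < r2.
  by rewrite (le_lt_trans zx)// (lt_le_trans hr)// ge_min lexx orbT.
have -> : F1 x - F2 x = (F2 z - F2 x) - (F1 y - F1 x) by rewrite E; ring.
by rewrite (le_trans (ler_normB _ _))// [leRHS]splitr lerD// ltW.
Qed.

Lemma schwarz_symmetry g u v :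
  (forall x, derivable g x u) -> (forall x, derivable g x v) ->
  (forall x, derivable ('D_u g) x v) -> (forall x, derivable ('D_v g) x u) ->
  continuous ('D_v ('D_u g)) -> continuous ('D_u ('D_v g)) ->
  'D_v ('D_u g) = 'D_u ('D_v g).
Proof.
move=> gu gv guv gvu cuv cvu; apply/funext => x.
have N0 : 0 <= `|u| + `|v| by rewrite addr_ge0.
apply: (eq_by_continuity N0 cuv cvu) => h h0.
have [y yx E1] := second_difference x h gu guv.
have [z zx E2] := second_difference x h gv gvu.
exists y, z; rewrite (gtr0_norm h0) in yx zx.
split; [exact: yx|by rewrite [`|u| + _]addrC|].
have hh : h * h != 0 by rewrite mulf_neq0 ?gt_eqF.
apply: (mulIf hh); apply: etrans (esym E1) _; apply: etrans _ E2.
by rewrite (addrAC x (h *: v)); congr (_ + _); rewrite [LHS]addrAC.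
Qed.

End DirectionalDerivatives.

(** * Gradient, Hessian and third derivative along lines *)

Section Coordinates.
Context {R : realType} {n : nat}.
Implicit Types (f g : 'cV[R]_n -> R) (x d v : 'cV[R]_n) (t : R).

Lemma is_derive_bigsum (I : Type) (r : seq I) (F : I -> R -> R) (dF : I -> R) t :
  (forall i, is_derive t 1 (F i) (dF i)) ->
  is_derive t 1 (fun s => \sum_(i <- r) F i s) (\sum_(i <- r) dF i).
Proof.
move=> DF; elim: r => [|i r ih].
  rewrite big_nil (_ : (fun _ => _) = (fun _ => 0)); first exact: is_derive_cst.
  by apply/funext => s; rewrite big_nil.
rewrite big_cons (_ : (fun _ => _) = (fun s => F i s + \sum_(i <- r) F i s)).
  exact: is_derive_add.
by apply/funext => s; rewrite big_cons.
Qed.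

(** Only the partial derivatives are given, so the direction is assembled one coordinate at a
    time. *)
Lemma is_derive_grad g : cont_diff 1 g ->
  forall d x, is_derive x d g (dot (grad g x) d).
Proof.
move=> [_ gC] d.
suff h (s : seq 'I_n) x : is_derive x (\sum_(i <- s) d i 0 *: delta_mx i 0) g
    (\sum_(i <- s) partial i g x * d i 0).
  move=> x; have := h (index_enum _) x.
  have -> : \sum_i partial i g x * d i 0 = dot (grad g x) d.
    by rewrite dotE; apply: eq_bigr => i _; rewrite mxE.
  suff -> : \sum_i d i 0 *: delta_mx i 0 = d by [].
  by rewrite [RHS]matrix_sum_delta; apply: eq_bigr => i _; rewrite big_ord1.
have part i y : is_derive y (d i 0 *: delta_mx i 0) g (partial i g y * d i 0).
  by apply/is_derive_scale_dir/derivableP; have [] := gC i.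
elim: s x => [|i s ih] x.
  by rewrite !big_nil; exact: is_derive0.
(* The new coordinate is moved to the second place, the one whose derivative must be continuous. *)
rewrite !big_cons [X in is_derive _ X]addrC [X in is_derive _ _ _ X]addrC.
have -> : \sum_(j <- s) partial j g x * d j 0 =
    'D_(\sum_(j <- s) d j 0 *: delta_mx j 0) g x by rewrite (@derive_val _ _ _ _ _ _ _ (ih x)).
have -> : partial i g x * d i 0 = 'D_(d i 0 *: delta_mx i 0) g x.
  by rewrite (@derive_val _ _ _ _ _ _ _ (part i x)).
apply: is_derive_add_dir => [y|y|].
- by have [] := ih y.
- by have [] := part i y.
have -> : 'D_(d i 0 *: delta_mx i 0) g = (fun y => partial i g y * d i 0).
  by apply/funext => y; rewrite (@derive_val _ _ _ _ _ _ _ (part i y)).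
have [_ [cpart _]] := gC i.
move=> y; apply: continuousM; [exact: cpart|exact: cst_continuous].
Qed.

Lemma is_derive_line_grad g x d t : cont_diff 1 g ->
  is_derive t 1 (fun s => g (x + s *: d)) (dot (grad g (x + t *: d)) d).
Proof. by move=> gC; apply/is_derive_line/is_derive_grad. Qed.

Lemma cont_diffW k g : cont_diff k.+1 g -> cont_diff k g.
Proof.
elim: k g => [|k ih] g [gc gp]; first by split.
by split=> // i; have [gi gik] := gp i; split=> //; exact: ih.
Qed.

Lemma cont_diff_partial k g i : cont_diff k.+1 g -> cont_diff k (partial i g).
Proof. by move=> [_ gp]; have [] := gp i. Qed.

Lemma hess_sym f x : cont_diff 2 f -> (hess f x)^T = hess f x.
Proof.
move=> fC; apply/matrixP => i j; rewrite !mxE.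
have [_ fp] := fC; have [fi fi1] := fp i; have [fj fj1] := fp j.
have [_ fip] := fi1; have [_ fjp] := fj1.
have [fij [fijc _]] := fip j; have [fji [fjic _]] := fjp i.
exact: (congr1 (fun F => F x) (schwarz_symmetry fj fi fji fij fjic fijc)).
Qed.

Lemma hess_mulmxE f x d i : (hess f x *m d) i 0 = dot (grad (partial i f) x) d.
Proof. by rewrite mxE dotE; apply: eq_bigr => j _; rewrite !mxE. Qed.

Lemma is_derive_line_hess f x v d t : cont_diff 2 f ->
  is_derive t 1 (fun s => dot v (grad f (x + s *: d)))
    (dot v (hess f (x + t *: d) *m d)).
Proof.
move=> fC; rewrite dotE.
have -> : (fun s => dot v (grad f (x + s *: d))) =
    (fun s => \sum_i v i 0 * partial i f (x + s *: d)).
  by apply/funext => s; rewrite dotE; apply: eq_bigr => i _; rewrite mxE.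
apply: is_derive_bigsum => i; rewrite hess_mulmxE; apply: is_derive_mull.
exact/is_derive_line_grad/cont_diff_partial.
Qed.

Lemma is_derive_line_third f x d t : cont_diff 3 f ->
  is_derive t 1 (fun s => dot d (hess f (x + s *: d) *m d))
    (third_form f (x + t *: d) d d d).
Proof.
move=> fC; rewrite /third_form.
have -> : (fun s => dot d (hess f (x + s *: d) *m d)) =
    (fun s => \sum_i \sum_j (d i 0 * d j 0) * partial j (partial i f) (x + s *: d)).
  apply/funext => s; rewrite dotE; apply: eq_bigr => i _.
  by rewrite mxE big_distrr /=; apply: eq_bigr => j _; rewrite !mxE; ring.
apply: is_derive_bigsum => i; apply: is_derive_bigsum => j.
have -> : \sum_k partial k (partial j (partial i f)) (x + t *: d) * d i 0 * d j 0 * d k 0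
    = (d i 0 * d j 0) * dot (grad (partial j (partial i f)) (x + t *: d)) d.
  by rewrite dotE big_distrr /=; apply: eq_bigr => k _; rewrite mxE; ring.
apply: is_derive_mull.
exact/is_derive_line_grad/cont_diff_partial/cont_diff_partial.
Qed.

End Coordinates.

(** * Smooth strongly convex functions *)

Section SmoothStronglyConvex.
Context {R : realType} {n : nat}.
Implicit Types (x y z d v : 'cV[R]_n) (A : 'M[R]_n).

(** One-sided increments are enough for a bound on the derivative. The range [h <= 1] is that of the
    convexity inequality, and [h * m] absorbs second-order remainders. *)
Lemma derive_le_of_quotient (F : R -> R) (l c m : R) : is_derive (0 : R) 1 F l ->
  (forall h, 0 < h <= 1 -> F h - F 0 <= h * (c + h * m)) -> l <= c.
Proof.
move=> [+ <-] Fle; rewrite /derivable => /cvg_ex[l' dl].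
rewrite /derive (cvg_lim _ dl)//; apply/ler_addgt0Pl => e e0.
have e2 : 0 < e / 2 by rewrite divr_gt0.
have /cvgrPdist_lt /(_ _ e2) /nbhs_ballP[r /= r0 rP] := dl.
have N0 : 0 < `|m| + 1 by rewrite ltr_wpDl.
pose h := Num.min (Num.min (r / 2) 1) (e / 2 / (`|m| + 1)).
have h0 : 0 < h by rewrite !lt_min ltr01 !divr_gt0.
have h1 : h <= 1 by rewrite !ge_min lexx orbT.
have hr : h < r.
  by apply: (@le_lt_trans _ _ (r / 2)); [rewrite !ge_min lexx|rewrite ltr_pdivrMr//; lra].
have hm : h * m <= e / 2.
  apply: (@le_trans _ _ (h * (`|m| + 1))).
    by rewrite ler_pM2l// (le_trans (ler_norm m))// lerDl.
  by rewrite -ler_pdivlMr// !ge_min lexx orbT.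
have := rP h; rewrite -ball_normE /= sub0r normrN (gtr0_norm h0).
move=> /(_ hr (lt0r_neq0 h0)); rewrite [h *: 1]mulr1 addr0.
have q : h^-1 *: (F h - F 0) <= c + h * m.
  by rewrite [leLHS]mulrC ler_pdivrMr// mulrC Fle// h0.
rewrite ltr_norml => /andP[_ h3]; lra.
Qed.

Variables (f : 'cV[R]_n -> R) (mu L L2 : R).
Hypothesis mu_gt0 : 0 < mu.
Hypothesis L_gt0 : 0 < L.
Hypothesis fC : cont_diff 2 f.
Hypothesis f_sc : strongly_convex mu f.

Lemma strongly_convex_segment x y (t : R) : 0 <= t <= 1 ->
  f (x + t *: (y - x)) <= f x + t * (f y - f x).
Proof.
move=> /andP[t0 t1].
have := f_sc y x; move=> /(_ t); rewrite t0 t1 => /(_ isT).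
have -> : t *: y + (1 - t) *: x = x + t *: (y - x).
  by rewrite scalerBl scale1r scalerBr addrCA.
have : 0 <= t * (1 - t) * mu / 2 * enorm (y - x) ^+ 2.
  rewrite mulr_ge0 ?sqr_ge0// divr_ge0// mulr_ge0 ?(ltW mu_gt0)//.
  by rewrite mulr_ge0// subr_ge0.
lra.
Qed.

Lemma strongly_convex_sublevel x y (c t : R) : 0 <= t <= 1 ->
  f x <= c -> f y <= c -> f (x + t *: (y - x)) <= c.
Proof.
move=> t01 fx fy; apply: le_trans (strongly_convex_segment _ _ t01) _.
by case/andP: t01 => t0 t1; nra.
Qed.

Lemma strongly_convex_first_order x y :
  f x + dot (grad f x) (y - x) + mu / 2 * dot (y - x) (y - x) <= f y.
Proof.
have D := is_derive_line_grad x (y - x) 0 (cont_diffW fC).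
rewrite scale0r addr0 in D.
suff : dot (grad f x) (y - x) <= f y - f x - mu / 2 * dot (y - x) (y - x) by lra.
apply: (derive_le_of_quotient (m := mu / 2 * dot (y - x) (y - x)) D) => h /andP[h0 h1].
rewrite scale0r addr0; have := f_sc y x; move=> /(_ h).
rewrite h1 (ltW h0) => /(_ isT); rewrite enorm_sqr.
have -> : h *: y + (1 - h) *: x = x + h *: (y - x).
  by rewrite scalerBl scale1r scalerBr addrCA.
lra.
Qed.

Lemma hess_ge x d : mu * dot d d <= dot d (hess f x *m d).
Proof.
have D := is_derive_line_hess x d d 0 fC; rewrite scale0r addr0 in D.
suff : - dot d (hess f x *m d) <= - (mu * dot d d) by rewrite lerN2.
(* The sign is reversed because [derive_le_of_quotient] bounds derivatives from above. *)
have := is_derive_mull (-1) D; rewrite mulN1r => {}D.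
apply: (derive_le_of_quotient (m := 0) D) => h /andP[h0 h1].
rewrite scale0r addr0.
have := strongly_convex_first_order x (x + h *: d).
have := strongly_convex_first_order (x + h *: d) x.
have -> : x - (x + h *: d) = - (h *: d) by rewrite opprD addrA subrr add0r.
have -> : x + h *: d - x = h *: d by rewrite addrC addKr.
rewrite !(dotNr, dotNl) opprK !(dotZr, dotZl) !(dotC (grad _ _)) => h2 h3.
have : h * (h * mu * dot d d) <= h * (dot d (grad f (x + h *: d)) - dot d (grad f x)).
  by lra.
by rewrite ler_pM2l//; lra.
Qed.

Lemma hess_le x d : lipschitz_grad L f ->
  dot d (hess f x *m d) <= L * dot d d.
Proof.
move=> fL; have D := is_derive_line_hess x d d 0 fC; rewrite scale0r addr0 in D.
apply: (derive_le_of_quotient (m := 0) D) => h /andP[h0 h1].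
rewrite scale0r addr0 -dotBr mulr0 addr0.
apply: le_trans (ler_norm _) _; apply: le_trans (cauchy_schwarz _ _) _.
have := fL (x + h *: d) x; have -> : x + h *: d - x = h *: d by rewrite addrC addKr.
rewrite enormZ (gtr0_norm h0) => h2.
apply: le_trans (ler_wpM2l (enorm_ge0 _) h2) _.
by rewrite -enorm_sqr le_eqVlt; apply/orP; left; apply/eqP; ring.
Qed.

Lemma hess_posdef x : posdefmx (hess f x).
Proof.
split; first exact: hess_sym.
move=> v v0; apply: lt_le_trans (hess_ge x v).
by rewrite mulr_gt0// dot_gt0.
Qed.

Section Minimizer.
Variable xs : 'cV[R]_n.
Hypothesis xs_min : forall z, f xs <= f z.

Lemma grad_minimizer : grad f xs = 0.
Proof.
suff h v : 0 <= dot (grad f xs) v.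
  apply/eqP; have := h (- grad f xs); rewrite dotNr oppr_ge0.
  by apply: contraTT; rewrite -dot_gt0 ltNge.
have D := is_derive_line_grad xs v 0 (cont_diffW fC); rewrite scale0r addr0 in D.
rewrite -oppr_le0; have := is_derive_mull (-1) D; rewrite mulN1r => {}D.
apply: (derive_le_of_quotient (m := 0) D) => h _.
by rewrite scale0r addr0; have := xs_min (xs + h *: v); lra.
Qed.

Lemma minimizer_dist x : mu / 2 * dot (x - xs) (x - xs) <= f x - f xs.
Proof.
have := strongly_convex_first_order xs x.
by rewrite grad_minimizer dot0l; lra.
Qed.

(** The Polyak-Lojasiewicz inequality: the first-order lower bound is combined with the square of
    [g + mu e], where [e = xs - x]. *)
Lemma gradient_domination x : 2 * mu * (f x - f xs) <= dot (grad f x) (grad f x).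
Proof.
have := strongly_convex_first_order x xs.
have := dot_ge0 (grad f x + mu *: (xs - x)); move: (xs - x) => e.
rewrite !(dotDl, dotDr, dotZl, dotZr) (dotC e) => h1 h2.
have : 2 * mu * (f x + dot (grad f x) e + mu / 2 * dot e e) <= 2 * mu * f xs by rewrite ler_pM2l// mulr_gt0.
lra.
Qed.

Lemma grad_neq0_gt_min x : grad f x != 0 -> f xs < f x.
Proof.
move=> g0; rewrite lt_neqAle xs_min andbT; apply: contra g0 => /eqP fx.
have := minimizer_dist x; rewrite -fx subrr pmulr_rle0 ?divr_gt0// => h.
suff /eqP : x - xs == 0 by move/subr0_eq => ->; rewrite grad_minimizer.
by apply: contraTT h; rewrite -dot_gt0 -ltNge.
Qed.

End Minimizer.

End SmoothStronglyConvex.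

(** * The spectral norm as a bound on quadratic forms *)

Section SpectralNorm.
Context {R : realType} {n : nat}.
Implicit Types (A : 'M[R]_n) (v : 'cV[R]_n).

(** [sup] has a default value on unbounded sets. The Frobenius norm of [A] is the bound that makes
    [spectral_norm] a true supremum. *)
Lemma enorm_mulmx_bounded A : exists C, forall v, enorm v <= 1 -> enorm (A *m v) <= C.
Proof.
exists (Num.sqrt (\sum_i dot (row i A)^T (row i A)^T)) => v v1.
apply: ler_wsqrtr; rewrite [in leLHS]dotE; apply: ler_sum => i _.
have -> : (A *m v) i 0 = dot (row i A)^T v.
  by rewrite mxE dotE; apply: eq_bigr => j _; rewrite !mxE.
rewrite -expr2 -real_normK ?num_real//.
have := cauchy_schwarz (row i A)^T v => h.
rewrite -[leRHS]enorm_sqr lerXn2r ?nnegrE ?enorm_ge0//.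
by apply: le_trans h _; rewrite ler_piMr// enorm_ge0.
Qed.

Lemma spectral_norm_le A v : enorm (A *m v) <= spectral_norm A * enorm v.
Proof.
have [C AC] := enorm_mulmx_bounded A.
have [->|v0] := eqVneq v 0.
  by rewrite mulmx0 /enorm !dot0l sqrtr0 mulr0.
have nv : 0 < enorm v by rewrite enorm_gt0.
rewrite -ler_pdivrMr//.
have -> : enorm (A *m v) / enorm v = enorm (A *m ((enorm v)^-1 *: v)).
  by rewrite -scalemxAr enormZ gtr0_norm ?invr_gt0// mulrC.
apply: ub_le_sup.
  by exists C => _ [w /= w1 <-]; exact: AC.
exists ((enorm v)^-1 *: v) => //=.
by rewrite enormZ gtr0_norm ?invr_gt0// mulVf// gt_eqF.
Qed.

Lemma spectral_norm_form A v : dot v (A *m v) <= spectral_norm A * dot v v.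
Proof.
apply: le_trans (ler_norm _) _; apply: le_trans (cauchy_schwarz _ _) _.
rewrite -enorm_sqr expr2 mulrCA; apply: ler_wpM2l; first exact: enorm_ge0.
exact: spectral_norm_le.
Qed.

End SpectralNorm.

(** * Variation of the Hessian on a sublevel set *)

Section SecantBound.
Context {R : realType} {n : nat}.
Implicit Types (x s v w : 'cV[R]_n) (P : 'M[R]_n).

(* Integrating 2 w^T H s <= w^T P w + K s^T H s over the segment, where H <= K P
   is the Hessian and P w is the gradient difference. *)
Lemma secant_bound (f : 'cV[R]_n -> R) x s w P (K : R) : cont_diff 2 f -> 0 < K ->
  (forall z v, 0 <= dot v (hess f z *m v)) ->
  (forall t v, 0 <= t <= 1 ->
    dot v (hess f (x + t *: s) *m v) <= K * dot v (P *m v)) ->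
  P *m w = grad f (x + s) - grad f x ->
  dot w (P *m w) <= K * dot (P *m w) s.
Proof.
move=> fC K0 H0 HP Pw.
have D v t := is_derive_line_hess x v s t fC.
have := @ler_derive R (fun t => 2 * dot w (grad f (x + t *: s)))
  (fun t => dot w (P *m w) * t + K * dot s (grad f (x + t *: s)))
  (fun t => 2 * dot w (hess f (x + t *: s) *m s))
  (fun t => dot w (P *m w) * 1 + K * dot s (hess f (x + t *: s) *m s)) 0 1 ler01.
rewrite scale1r scale0r addr0 => h.
have {h} : 2 * dot w (grad f (x + s)) - 2 * dot w (grad f x) <=
    dot w (P *m w) * 1 + K * dot s (grad f (x + s))
      - (dot w (P *m w) * 0 + K * dot s (grad f x)).
  apply: h => t t01.
  (* The pointwise inequality is the nonnegativity of [H] at [w - K s], with [w^T H w] replaced by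
     [K w^T P w] and then divided by [K]. *)
  have := H0 (x + t *: s) (w - K *: s); have := HP t w t01.
  set H := hess f _.
  have HT : dot s (H *m w) = dot w (H *m s).
    by rewrite dot_mulmx hess_sym// dotC.
  rewrite mulmxBr -scalemxAr !(dotBl, dotBr, dotZl, dotZr) HT => h1 h2.
  rewrite -(ler_pM2l K0); lra.
move=> h.
have E1 : dot w (P *m w) = dot w (grad f (x + s)) - dot w (grad f x).
  by rewrite Pw dotBr.
have -> : dot (P *m w) s = dot s (grad f (x + s)) - dot s (grad f x).
  by rewrite Pw dotC dotBr.
lra.
Qed.

End SecantBound.

Section Sublevel.
Context {R : realType} {n : nat}.
Implicit Types (x z v w : 'cV[R]_n).
Variables (f : 'cV[R]_n -> R) (mu M L2 : R) (xs : 'cV[R]_n).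
Hypothesis mu_gt0 : 0 < mu.
Hypothesis M_gt0 : 0 < M.
Hypothesis L2_gt0 : 0 < L2.
Hypothesis fC : cont_diff 3 f.
Hypothesis f_sc : strongly_convex mu f.
Hypothesis f_conc : self_concordant M f.
Hypothesis f_hess : lipschitz_hess L2 f.
Hypothesis xs_min : forall z, f xs <= f z.

Let fC2 : cont_diff 2 f := cont_diffW fC.

(** Bounds the relative deviation of the Hessian from [hess f xs] where [f] exceeds its minimum by
    at most [delta]: such points are within [sqrt (2 delta / mu)] of [xs], the Hessian varies by
    [L2] times that, and dividing by [mu] makes it relative. *)
Definition hess_drift (delta : R) : R :=
  2 * Num.sqrt 2 * (L2 / (2 * mu `^ (3 / 2))) * Num.sqrt delta.

Lemma hess_driftE delta : 0 <= delta ->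
  hess_drift delta = L2 * Num.sqrt (2 * delta / mu) / mu.
Proof.
move=> d0.
have smu : 0 < Num.sqrt mu by rewrite sqrtr_gt0.
have mu2 : mu = Num.sqrt mu ^+ 2 by rewrite sqr_sqrtr ?ltW.
rewrite /hess_drift; have -> : mu `^ (3 / 2) = Num.sqrt mu ^+ 3.
  by rewrite mulrC powRrM powR12_sqrt ?(ltW mu_gt0)// powR_mulrn ?sqrtr_ge0.
rewrite sqrtrM; last by rewrite mulr_ge0.
rewrite sqrtrM// sqrtrV ?(ltW mu_gt0)//.
have -> : mu^-1 = Num.sqrt mu ^- 2 by rewrite -mu2.
by field; rewrite gt_eqF.
Qed.

Lemma hess_drift_ge0 delta : 0 <= hess_drift delta.
Proof.
apply: mulr_ge0; last exact: sqrtr_ge0.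
apply: mulr_ge0; first by rewrite mulr_ge0 ?sqrtr_ge0.
by rewrite divr_ge0 ?(ltW L2_gt0)// mulr_ge0 ?powR_ge0.
Qed.

Lemma hess_sublevel_le x z v : f z <= f x ->
  dot v (hess f z *m v) <=
  (1 + hess_drift (f x - f xs)) * dot v (hess f xs *m v).
Proof.
move=> fz; have d0 : 0 <= f x - f xs by rewrite subr_ge0.
rewrite hess_driftE//; set delta := f x - f xs in d0 *.
have -> : hess f z = hess f xs + (hess f z - hess f xs) by rewrite subrKC.
rewrite mulmxDl dotDr mulrDl mul1r lerD2l.
apply: le_trans (spectral_norm_form _ _) _.
apply: le_trans (ler_wpM2r (dot_ge0 _) (f_hess _ _)) _.
have dist : enorm (z - xs) <= Num.sqrt (2 * delta / mu).
  apply: ler_wsqrtr; rewrite ler_pdivlMr//.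
  have := minimizer_dist fC2 f_sc xs_min z; rewrite /delta; lra.
have vv : dot v v <= dot v (hess f xs *m v) / mu.
  by rewrite ler_pdivlMr// mulrC; exact: (hess_ge fC2 f_sc).
rewrite -mulrA [mu^-1 * _]mulrC; apply: ler_pM => //.
- by rewrite mulr_ge0 ?enorm_ge0// ltW.
- exact: dot_ge0.
- by rewrite ler_pM2l.
Qed.

(** Unlike in [gradient_domination], the factors tend to 1 as [x] approaches [xs]. Let [e = x - xs]
    and [q] its norm for [P = hess f xs]. Self-concordance from [xs] gives [1 + M q <= exp s0],
    hence [q^2 <= exp s0 * e^T g]. Cauchy-Schwarz for [P] turns this into a bound by [g^T P^-1 g],
    and the drift of the Hessian bounds [2 delta] by [q^2]. *)
Lemma dual_norm_ge x w (delta := f x - f xs) :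
  f xs < f x -> hess f xs *m w = grad f x ->
  2 * delta <= expR (2 * (Num.sqrt 2 * M * Num.sqrt delta))
    * (1 + hess_drift delta) * dot w (grad f x).
Proof.
move=> fx Pw.
have d0 : 0 < delta by rewrite subr_gt0.
set s0 := Num.sqrt 2 * M * Num.sqrt delta.
have s00 : 0 < s0 by rewrite !mulr_gt0// sqrtr_gt0.
have s02 : s0 ^+ 2 / 2 = M ^+ 2 * delta.
  by rewrite /s0 !exprMn !sqr_sqrtr ?(ltW d0)//; field.
pose e := x - xs; pose P := hess f xs.
have e0 : e != 0 by rewrite subr_eq0; apply: contraTneq fx => ->; rewrite ltxx.
have xE : xs + 1 *: e = x by rewrite scale1r subrKC.
have Ppos := hess_posdef mu_gt0 fC2 f_sc xs.
have E0 : 0 < dot e (P *m e) by have [_] := Ppos; apply.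
have D0 t := is_derive_line_grad xs e t (cont_diffW fC2).
have D1 t := is_derive_line_hess xs e e t fC2.
have D2 t := is_derive_line_third xs e t fC.
have pos t : 0 < dot e (hess f (xs + t *: e) *m e).
  by have [_] := hess_posdef mu_gt0 fC2 f_sc (xs + t *: e); apply.
have third t := f_conc.2 (xs + t *: e) e.
pose q := Num.sqrt (dot e (P *m e)).
have q0 : 0 < q by rewrite sqrtr_gt0.
have q2 : q ^+ 2 = dot e (P *m e) by rewrite sqr_sqrtr// ltW.
have D0' (t : R) : is_derive t 1 (fun s => f (xs + s *: e)) (dot e (grad f (xs + t *: e))).
  by rewrite dotC.
have q2' : q ^+ 2 = dot e (hess f (xs + 0 *: e) *m e) by rewrite scale0r addr0.
have := self_concordant_ge M_gt0 D0' D1 D2 pos third q0 q2' ler01.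
have := self_concordant_ge1 M_gt0 D1 D2 pos third q0 q2' ler01.
rewrite xE -q2' scale0r addr0 (grad_minimizer fC2 xs_min) dot0r mul0r add0r subr0 !mulr1.
move=> ge1 ge0.
have a0 : 0 <= M * q by rewrite mulr_ge0 ?ltW.
have a1 : 0 < 1 + M * q by rewrite ltr_wpDr.
have oa : omega (M * q) <= s0 ^+ 2 / 2.
  by rewrite s02 [leRHS]mulrC -ler_pdivrMr ?exprn_gt0.
have aexp : 1 + M * q <= expR s0.
  apply: le_trans (expR_ge_quadratic (ltW s00)).
  by rewrite -addrA lerD2l; exact: omega_le.
have Ele : q ^+ 2 <= expR s0 * dot e (grad f x).
  have ge1' := ge1; move: ge1; rewrite ler_pdivrMr// mulrC => ge1.
  apply: le_trans ge1 _; rewrite ler_wpM2r//.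
  by apply: le_trans ge1'; rewrite divr_ge0 ?sqr_ge0// ltW.
have up : delta <= (1 + hess_drift delta) * q ^+ 2 / 2.
  have := @quadratic_upper_bound R (fun s => f (xs + s *: e)) _ _
    ((1 + hess_drift delta) * q ^+ 2) 0 1 ler01 D0' D1.
  rewrite xE scale0r addr0 (grad_minimizer fC2 xs_min) dot0r mul0r add0r subr0.
  rewrite expr1n mulr1; apply => t t01; rewrite q2; apply: hess_sublevel_le.
  by apply: (strongly_convex_sublevel mu_gt0 f_sc t01) => //; exact: ltW.
have cs : dot e (grad f x) ^+ 2 <= dot w (grad f x) * q ^+ 2.
  rewrite -Pw q2 [leRHS]mulrC; apply: psd_cauchy_schwarz; first by case: Ppos.
  by move=> v; exact: posdefmx_ge0.
have C0 : 0 <= 1 + hess_drift delta by rewrite addr_ge0// hess_drift_ge0.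
have q20 : 0 < q ^+ 2 by rewrite exprn_gt0.
have qle : q ^+ 2 <= expR (2 * s0) * dot w (grad f x).
  rewrite -(ler_pM2l q20); apply: (@le_trans _ _ ((expR s0 * dot e (grad f x)) ^+ 2)).
    by rewrite -expr2 lerXn2r ?nnegrE// ?(ltW q20)// (le_trans (ltW q20)).
  by rewrite exprMn expRM_natl [leRHS]mulrCA ler_pM2l ?exprn_gt0 ?expR_gt0// [leRHS]mulrC.
apply: (@le_trans _ _ ((1 + hess_drift delta) * q ^+ 2)).
  by rewrite mulrC -ler_pdivlMr.
by rewrite [expR _ * _]mulrC -mulrA; apply: ler_wpM2l.
Qed.
End Sublevel.

(** * One step of the algorithm *)

Section StepScalars.
Context {R : realType}.

(** Here [p] is the decrease, [sigma] the slope [- g^T s] and [b] the curvature [y^T s]. The second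
    bound uses [z (1 + w) <= (1 + 2 z) w], from the damped Newton step, and [1 + 2 z <= (1 + s0)^2];
    the third uses [w >= z alpha^2]. *)
Lemma step_ratio_bounds (z alpha M p sigma b delta s0 kappa : R) :
  let w := scaled_step z alpha in
  0 < z -> 0 < alpha -> alpha <= 1 -> 0 < M -> 0 < kappa -> 0 < s0 ->
  s0 ^+ 2 / 2 = M ^+ 2 * delta -> p <= delta ->
  omega z <= M ^+ 2 * p -> z * w / 2 <= M ^+ 2 * p ->
  sigma = w * z / M ^+ 2 ->
  w ^+ 2 / (1 + w) <= M ^+ 2 * b ->
  w ^+ 2 / (alpha ^+ 2 * kappa) <= M ^+ 2 * b ->
  [/\ sigma <= 2 * p, sigma <= (1 + s0) ^+ 2 * b & sigma <= kappa * b].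
Proof.
move=> w z0 al0 al1 M0 k0 s00 s02 pd oz zw -> b1 b2.
have M2 : 0 < M ^+ 2 by rewrite exprn_gt0.
have w0 : 0 < w by exact: scaled_step_gt0.
have wz : z / (1 + z) <= w by exact: scaled_step_ge.
have wa : z * alpha ^+ 2 <= w by exact: scaled_step_ge_sqr.
have z1 : 0 < 1 + z by rewrite ltr_wpDr// ltW.
have w1 : 0 < 1 + w by rewrite ltr_wpDr// ltW.
have zs : z <= s0 + s0 ^+ 2 / 2.
  apply: omega_le => //; first exact: ltW.
  by rewrite s02 (le_trans oz)// ler_pM2l.
split; rewrite ler_pdivrMr//.
- lra.
- apply: (@le_trans _ _ ((1 + s0) ^+ 2 * (w ^+ 2 / (1 + w)))); last first.
    have -> : (1 + s0) ^+ 2 * b * M ^+ 2 = (1 + s0) ^+ 2 * (M ^+ 2 * b) by ring.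
    by rewrite ler_wpM2l ?sqr_ge0.
  rewrite mulrA ler_pdivlMr//.
  move: wz; rewrite ler_pdivrMr// => wz.
  have : w * (z * (1 + w)) <= w * ((1 + 2 * z) * w) by rewrite ler_pM2l//; lra.
  have : (1 + 2 * z) * w ^+ 2 <= (1 + s0) ^+ 2 * w ^+ 2.
    by rewrite ler_wpM2r ?sqr_ge0//; lra.
  lra.
- apply: (@le_trans _ _ (kappa * (w ^+ 2 / (alpha ^+ 2 * kappa)))); last first.
    have -> : kappa * b * M ^+ 2 = kappa * (M ^+ 2 * b) by ring.
    by rewrite ler_wpM2l// ltW.
  have -> : kappa * (w ^+ 2 / (alpha ^+ 2 * kappa)) = w * (w / alpha ^+ 2).
    by field; rewrite !gt_eqF.
  by rewrite ler_pM2l// ler_pdivlMr// exprn_gt0.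
Qed.

End StepScalars.

Section BfgsStep.
Context {R : realType} {n : nat}.
Implicit Types (x z v w : 'cV[R]_n) (B : 'M[R]_n).
Variables (f : 'cV[R]_n -> R) (mu L M : R) (xs : 'cV[R]_n).
Hypothesis mu_gt0 : 0 < mu.
Hypothesis L_gt0 : 0 < L.
Hypothesis M_gt0 : 0 < M.
Hypothesis fC : cont_diff 3 f.
Hypothesis f_sc : strongly_convex mu f.
Hypothesis f_grad : lipschitz_grad L f.
Hypothesis f_conc : self_concordant M f.
Hypothesis xs_min : forall z, f xs <= f z.

Let fC2 : cont_diff 2 f := cont_diffW fC.

Variables (x : 'cV[R]_n) (B : 'M[R]_n).
Hypothesis B_posdef : posdefmx B.
Hypothesis g_neq0 : grad f x != 0.

Let d := bfgs_dir f x B.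
Let t := bfgs_stepsize f L M x d.
Let x' := x + t *: d.

Let gd_lt0 : 0 < - dot (grad f x) d.
Proof.
by rewrite /d /bfgs_dir dotNr opprK; have [_] := posdefmx_inv B_posdef; apply.
Qed.

Lemma bfgs_step_spec (s0 := Num.sqrt 2 * M * Num.sqrt (f x - f xs))
    (sigma := - dot (grad f x) (t *: d)) (b := dot (grad f x' - grad f x) (t *: d)) :
  [/\ 0 < t, 0 < sigma, sigma <= 2 * (f x - f x'),
      sigma <= (1 + s0) ^+ 2 * b & sigma <= L / mu * b].
Proof.
have d0 : d != 0 by apply: contraTneq gd_lt0 => ->; rewrite dot0r oppr0 ltxx.
have nd : 0 < enorm d by rewrite enorm_gt0.
have dd : 0 < dot d d by rewrite dot_gt0.
have sL : 0 < Num.sqrt L by rewrite sqrtr_gt0.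
pose q := local_norm f x d.
have q0 : 0 < q.
  by rewrite sqrtr_gt0; have [_] := hess_posdef mu_gt0 fC2 f_sc x; apply.
have q2 : q ^+ 2 = dot d (hess f (x + 0 *: d) *m d).
  rewrite scale0r addr0 sqr_sqrtr//; apply: posdefmx_ge0.
  exact: (hess_posdef mu_gt0 fC2 f_sc).
pose alpha := bfgs_alpha f L x d; pose z := M * bfgs_eta f x d.
have al0 : 0 < alpha by rewrite divr_gt0// mulr_gt0.
have eta0 : 0 < bfgs_eta f x d by rewrite divr_gt0.
have z0 : 0 < z by rewrite mulr_gt0.
have q2al : q ^+ 2 / alpha ^+ 2 = L * dot d d.
  rewrite /alpha /bfgs_alpha -/q -enorm_sqr -{2}(sqr_sqrtr (ltW L_gt0)).
  by field; rewrite !gt_eqF.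
have al1 : alpha <= 1.
  rewrite -(@ler_pXn2r _ 2)// ?nnegrE ?(ltW al0)// expr1n.
  have := hess_le fC2 x d f_grad.
  rewrite -q2al ler_pdivlMr ?exprn_gt0//.
  by rewrite -[X in hess f X](addr0 x) -(scale0r d) -q2 ger_pMr ?exprn_gt0.
have tE : t = scaled_step z alpha / (M * q).
  rewrite /t /bfgs_stepsize /scaled_step -/alpha -/z -/q; case: ifP => _.
    by rewrite /z; field; rewrite !gt_eqF// ltr_wpDr// ltW.
  by [].
have D0 (u : R) : is_derive u 1 (fun s => f (x + s *: d)) (dot d (grad f (x + u *: d))).
  by rewrite dotC; exact: is_derive_line_grad (cont_diffW fC2).
have D1 u := is_derive_line_hess x d d u fC2.
have D2 u := is_derive_line_third x d u fC.
have pos u : 0 < dot d (hess f (x + u *: d) *m d).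
  by have [_] := hess_posdef mu_gt0 fC2 f_sc (x + u *: d); apply.
have third u := f_conc.2 (x + u *: d) d.
have phi10 : dot d (grad f (x + 0 *: d)) = - (z / M * q).
  rewrite scale0r addr0 dotC /z /bfgs_eta -/q; field; rewrite !gt_eqF//.
have phi2le u : dot d (hess f (x + u *: d) *m d) <= q ^+ 2 / alpha ^+ 2.
  by rewrite q2al; exact: hess_le.
have [dec1 dec2] := step_decrease z0 al0 al1 M_gt0 D0 D1 D2 pos third q0 q2 phi10 phi2le.
have cur := step_curvature_ge alpha z0 M_gt0 D1 D2 pos third q0 q2.
rewrite -tE scale0r addr0 -/x' in dec1 dec2 cur.
have w0 : 0 < scaled_step z alpha by exact: scaled_step_gt0.
have t0 : 0 < t by rewrite tE divr_gt0// mulr_gt0.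
have bE : b = t * (dot d (grad f x') - dot d (grad f x)).
  by rewrite /b dotZr dotC dotBr.
have Delta0 : 0 < f x - f xs.
  by rewrite subr_gt0; exact: (grad_neq0_gt_min mu_gt0 fC2 f_sc xs_min).
have s00 : 0 < s0 by rewrite !mulr_gt0// sqrtr_gt0.
have s02 : s0 ^+ 2 / 2 = M ^+ 2 * (f x - f xs).
  by rewrite /s0 !exprMn !sqr_sqrtr ?(ltW Delta0)//; field.
have sE : sigma = scaled_step z alpha * z / M ^+ 2.
  rewrite /sigma dotZr tE /z /bfgs_eta -/q; field; rewrite !gt_eqF//.
have M2 : 0 < M ^+ 2 by rewrite exprn_gt0.
have b1 : scaled_step z alpha ^+ 2 / (1 + scaled_step z alpha) <= M ^+ 2 * b.
  rewrite bE; apply: le_trans (ler_wpM2l (ltW M2) (ler_wpM2l (ltW t0) cur)).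
  rewrite tE le_eqVlt; apply/orP; left; apply/eqP.
  by field; rewrite !gt_eqF// ltr_wpDr// ltW.
(* Strong convexity gives curvature at least [mu t^2 ||d||^2], and [||d||^2 = q^2 / (alpha^2 L)] by
   definition of [alpha]. *)
have b2 : scaled_step z alpha ^+ 2 / (alpha ^+ 2 * (L / mu)) <= M ^+ 2 * b.
  have lin (u : R) : is_derive u 1 (fun s => mu * dot d d * s) (mu * dot d d).
    by rewrite -[X in is_derive _ _ _ X]mulr1; apply: is_derive_mull.
  have cur2 := ler_derive (ltW t0) (fun u _ => lin u) (fun u _ => D1 u)
    (fun u _ => hess_ge fC2 f_sc (x + u *: d) d).
  rewrite mulr0 subr0 scale0r addr0 -/x' in cur2.
  rewrite bE; apply: le_trans (ler_wpM2l (ltW M2) (ler_wpM2l (ltW t0) cur2)).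
  have ddE : dot d d = q ^+ 2 / alpha ^+ 2 / L.
    by rewrite q2al; field; rewrite gt_eqF.
  rewrite ddE tE le_eqVlt; apply/orP; left; apply/eqP.
  by field; rewrite !gt_eqF.
have k0 : 0 < L / mu by rewrite divr_gt0.
have pd : f x - f x' <= f x - f xs by rewrite lerD2l lerN2.
have [r1 r2 r3] := step_ratio_bounds z0 al0 al1 M_gt0 k0 s00 s02 pd dec1 dec2 sE b1 b2.
split; [exact: t0| |exact: r1|exact: r2|exact: r3].
by rewrite sE divr_gt0 ?exprn_gt0// mulr_gt0.
Qed.

Let s := t *: d.
Let y := grad f x' - grad f x.
Let B' := bfgs_update B s y.

Lemma bfgs_step_posdef : posdefmx B'.
Proof.
have [t0 sg0 _ _ sgb] := bfgs_step_spec; apply: bfgs_update_posdef => //.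
have k0 : 0 < L / mu by rewrite divr_gt0.
by rewrite -(pmulr_rgt0 _ k0); exact: lt_le_trans sg0 sgb.
Qed.

(** [K], [c] and [m] collect all that depends on the weight: [gap / p] is at most [2 c m] times
    [||S g||^2 y^T s / (g^T s)^2], and the logarithm of the latter is paid for by the drop of [Psi]
    and [K - 1]. *)
Lemma bfgs_step_rate (S : 'M[R]_n) (K c m : R) :
  let p := f x - f x' in
  posdefmx S -> 0 < m -> 0 < c ->
  dot (S *m y) (S *m y) <= K * dot y s ->
  f x - f xs <= c * dot (S *m grad f x) (S *m grad f x) ->
  - dot (grad f x) s <= m * dot y s ->
  0 < p /\ ln ((f x - f xs) / p) <=
    ln (2 * c * m) + (K - 1) + (Psi (S *m B *m S) - Psi (S *m B' *m S)).
Proof.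
move=> p S_pos m0 c0 yK fG sm.
have [t0 sg0 sgp _ sgb] := bfgs_step_spec.
rewrite -/s -/y in sg0 sgp sgb; rewrite -/p in sgp.
set sg := - dot _ s in sm sg0 sgp sgb; set b := dot y s in yK sm sgb.
have k0 : 0 < L / mu by rewrite divr_gt0.
have b0 : 0 < b by rewrite -(pmulr_rgt0 _ k0); exact: lt_le_trans sg0 sgb.
have p0 : 0 < p by rewrite -(@pmulr_rgt0 _ 2)//; exact: lt_le_trans sg0 sgp.
split; first exact: p0.
pose g := grad f x; pose G := dot (S *m g) (S *m g).
have G0 : 0 < G.
  rewrite dot_gt0; apply: contra g_neq0 => /eqP Sg; apply/eqP.
  by rewrite -/g -[g](mulKmx (posdefmx_unit S_pos)) Sg mulmx0.
have delta0 : 0 < f x - f xs.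
  by rewrite subr_gt0; exact: (grad_neq0_gt_min mu_gt0 fC2 f_sc xs_min).
have Bs : B *m s = - t *: g.
  rewrite /s -scalemxAr /d /bfgs_dir mulmxN mulKVmx ?posdefmx_unit//.
  by rewrite scalerN scaleNr.
have aE : dot s (B *m s) = t * sg.
  by rewrite Bs dotZr /sg dotC mulNr mulrN.
have upd : Psi (S *m B' *m S) = Psi (S *m B *m S) - t * G / sg
    + dot (S *m y) (S *m y) / b - ln (b / (t * sg)).
  rewrite (Psi_bfgs_update B_posdef b0 S_pos) -/b aE; congr (_ - _ + _ - _).
  rewrite Bs -scalemxAr dotZl dotZr -/G.
  by field; rewrite !gt_eqF.
(* The removed trace [t G / sg] is traded for its logarithm, so that [t] cancels against the [t] in
   the determinant ratio [b / (t sg)]. *)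
have zln : 1 + ln (t * G / sg) <= t * G / sg.
  have q0 : 0 < t * G / sg by rewrite divr_gt0// mulr_gt0.
  have := @le_ln1Dx _ (t * G / sg - 1).
  rewrite subrKC ltrBrDr addNr => /(_ q0).
  by rewrite -lerBrDl.
have lnE : ln (t * G / sg) + ln (b / (t * sg)) = ln (G * b / sg ^+ 2).
  rewrite -lnM ?posrE ?divr_gt0 ?mulr_gt0//.
  by congr ln; field; rewrite !gt_eqF.
have yb : dot (S *m y) (S *m y) / b <= K by rewrite ler_pdivrMr.
have c2m : 0 < 2 * c * m by rewrite !mulr_gt0.
have Gb0 : 0 < G * b / sg ^+ 2 by rewrite divr_gt0 ?exprn_gt0// mulr_gt0.
have ratio : (f x - f xs) / p <= 2 * c * m * (G * b / sg ^+ 2).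
  rewrite ler_pdivrMr// (le_trans fG)// -/g -/G.
  have -> : 2 * c * m * (G * b / sg ^+ 2) * p =
    c * G * ((m * b) * (2 * p) / sg ^+ 2) by field; rewrite gt_eqF.
  (* The extra factor is at least 1 since [sg <= m b] and [sg <= 2 p]. *)
  rewrite ler_peMr ?mulr_ge0 ?(ltW c0) ?(ltW G0)//.
  rewrite ler_pdivlMr ?exprn_gt0// mul1r expr2.
  by apply: ler_pM; rewrite ?(ltW sg0).
have h : ln ((f x - f xs) / p) <= ln (2 * c * m) + ln (G * b / sg ^+ 2).
  rewrite -lnM ?posrE// ler_ln ?posrE//; first exact: divr_gt0.
  exact: mulr_gt0.
apply: le_trans h _; rewrite -addrA lerD2l upd -lnE.
move: (_ / b) (t * G / sg) (Psi (S *m B *m S)) (ln (b / (t * sg)))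
  (ln (t * G / sg)) zln yb => a5 a4 a3 a2 a1 a14 a5K.
have -> : K - 1 + (a3 - (a3 - a4 + a5 - a2)) =
  (a4 - (1 + a1)) + (K - a5) + (a1 + a2) by ring.
by rewrite lerDr addr_ge0// subr_ge0.
Qed.

(** The segment from [x] to [x'] stays in the sublevel set of [x], so [secant_bound] gives
    [K = 1 + C]; [dual_norm_ge] gives [c], and [m = (1 + s0)^2]. *)
Lemma bfgs_step_superlinear (L2 : R)
    (S := sqrtmx (invmx (hess f xs))) :
  0 < L2 -> lipschitz_hess L2 f -> M <= L2 / (2 * mu `^ (3 / 2)) ->
  0 < f x - f x' /\ ln ((f x - f xs) / (f x - f x')) <=
    4 * hess_drift mu L2 (f x - f xs) + (Psi (S *m B *m S) - Psi (S *m B' *m S)).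
Proof.
move=> L2_gt0 f_hess MMt.
have P_pos := hess_posdef mu_gt0 fC2 f_sc xs.
have [S_pos SS] := sqrtmxP (posdefmx_inv P_pos); rewrite -/S in S_pos SS.
have Ssym : S^T = S by case: S_pos.
have PSS v : hess f xs *m (S *m (S *m v)) = v.
  by rewrite (mulmxA S) SS mulKVmx// posdefmx_unit.
have SSdot v : dot (S *m v) (S *m v) = dot (S *m (S *m v)) v.
  by rewrite [LHS]dot_mulmx Ssym.
have fx : f xs < f x by exact: (grad_neq0_gt_min mu_gt0 fC2 f_sc xs_min).
have d0 : 0 < f x - f xs by rewrite subr_gt0.
have [t0 sg0 sgp sgm _] := bfgs_step_spec.
have fx' : f x' <= f x.
  by rewrite -subr_ge0 -(@pmulr_rge0 _ 2)// ltW// (lt_le_trans sg0).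
set C := hess_drift mu L2 (f x - f xs).
set s0 := Num.sqrt 2 * M * Num.sqrt (f x - f xs) in sgm.
have C0 : 0 <= C by exact: hess_drift_ge0.
have C1 : 0 < 1 + C by rewrite ltr_wpDr.
have s00 : 0 < s0 by rewrite !mulr_gt0// sqrtr_gt0.
(* Here [M <= Mt] enters: the self-concordance error is absorbed into the drift of the Hessian. *)
have s0C : 2 * s0 <= C.
  rewrite /C /hess_drift /s0 !(mulrA 2) ler_wpM2r ?sqrtr_ge0//.
  by rewrite ler_wpM2l// mulr_ge0// sqrtr_ge0.
have yK : dot (S *m y) (S *m y) <= (1 + C) * dot y s.
  rewrite SSdot -{2 3}(PSS y); apply: (secant_bound fC2 C1) (PSS y) => [z v|u v u01].
    exact/posdefmx_ge0/(hess_posdef mu_gt0 fC2 f_sc).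
  apply: (hess_sublevel_le mu_gt0 L2_gt0 fC f_sc f_hess xs_min).
  have := strongly_convex_sublevel mu_gt0 f_sc u01 (lexx (f x)) fx'.
  by have -> : x' - x = s by rewrite /x' addrC addKr.
have fG : f x - f xs <= expR (2 * s0) * (1 + C) / 2 *
    dot (S *m grad f x) (S *m grad f x).
  have := dual_norm_ge mu_gt0 M_gt0 L2_gt0 fC f_sc f_conc f_hess xs_min fx (PSS _).
  rewrite -/s0 -/C SSdot => h.
  by rewrite mulrAC ler_pdivlMr// mulrC.
have m0 : 0 < (1 + s0) ^+ 2 by rewrite exprn_gt0// addr_gt0.
have c0 : 0 < expR (2 * s0) * (1 + C) / 2.
  by rewrite divr_gt0// mulr_gt0// expR_gt0.
have [p0 rate] := bfgs_step_rate S_pos m0 c0 yK fG sgm.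
split; first exact: p0.
apply: le_trans rate _; rewrite lerD2r.
have -> : 2 * (expR (2 * s0) * (1 + C) / 2) * (1 + s0) ^+ 2 =
   expR (2 * s0) * ((1 + C) * (1 + s0) ^+ 2) by field.
have m1 : 0 < 1 + s0 by rewrite addr_gt0.
have -> : ln (expR (2 * s0) * ((1 + C) * (1 + s0) ^+ 2)) =
    2 * s0 + (ln (1 + C) + ln (1 + s0) *+ 2).
  rewrite lnM ?posrE ?expR_gt0//; last by rewrite mulr_gt0.
  by rewrite expRK lnM ?posrE// lnXn.
have lC : ln (1 + C) <= C by apply: le_ln1Dx; rewrite (lt_le_trans _ C0)// ltrN10.
have ls : ln (1 + s0) <= s0.
  by apply: le_ln1Dx; rewrite (lt_trans _ s00)// ltrN10.
(* The logarithm costs at most [2 s0 + C + 2 s0] and [K - 1] costs [C]; the total [4 s0 + 2 C] is at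
   most [4 C]. *)
have -> : 4 * C = 2 * s0 + (C + s0 *+ 2) + (C + 2 * (C - 2 * s0)) by ring.
have -> : 1 + C - 1 = C by ring.
apply: lerD; last by rewrite lerDl mulr_ge0// subr_ge0.
by rewrite lerD2l lerD// lerMn2r ls orbT.
Qed.

(** [Gamma] may be any upper bound of the current factor, so its value at [x0] can serve every
    iterate. The weight is [L^(-1/2)] times the identity, for which [K = 1]. *)
Lemma bfgs_step_linear (Gamma : R) :
  (1 + Num.sqrt 2 * M * Num.sqrt (f x - f xs)) ^+ 2 <= Gamma ->
  0 < f x - f x' /\ ln ((f x - f xs) / (f x - f x')) <=
    ln (L / mu * Num.min Gamma (L / mu)) + (Psi (L^-1 *: B) - Psi (L^-1 *: B')).
Proof.
move=> le_Gamma.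
have sL : 0 < Num.sqrt L by rewrite sqrtr_gt0.
have k0 : 0 < L / mu by rewrite divr_gt0.
pose S : 'M[R]_n := (Num.sqrt L)^-1 %:M.
have S_pos : posdefmx S.
  split; first exact: tr_scalar_mx.
  by move=> v v0; rewrite mul_scalar_mx dotZr mulr_gt0 ?invr_gt0// dot_gt0.
have Sdot v : dot (S *m v) (S *m v) = dot v v / L.
  by rewrite !mul_scalar_mx dotZl dotZr mulrA -expr2 exprVn sqr_sqrtr ?(ltW L_gt0)// mulrC.
have SXS X : S *m X *m S = L^-1 *: X.
  rewrite mul_scalar_mx mul_mx_scalar scalerA -expr2 exprVn.
  by rewrite sqr_sqrtr// ltW.
have [t0 sg0 sgp sgm sgk] := bfgs_step_spec.
have b0 : 0 < dot y s by rewrite -(pmulr_rgt0 _ k0); exact: lt_le_trans sg0 sgk.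
have yK : dot (S *m y) (S *m y) <= 1 * dot y s.
  have Ly : L%:M *m (L^-1 *: y) = y.
    by rewrite mul_scalar_mx scalerA divff ?gt_eqF// scale1r.
  have := @secant_bound R n f x s (L^-1 *: y) L%:M 1 fC2 ltr01.
  rewrite Ly Sdot dotZl mulrC; apply => [z v|u v _|].
  - exact/posdefmx_ge0/(hess_posdef mu_gt0 fC2 f_sc).
  - by rewrite mul1r mul_scalar_mx dotZr; exact: hess_le.
  - by [].
have fG : f x - f xs <= L / mu / 2 * dot (S *m grad f x) (S *m grad f x).
  rewrite Sdot; have := gradient_domination mu_gt0 fC2 f_sc xs x.
  have -> : L / mu / 2 * (dot (grad f x) (grad f x) / L) =
    dot (grad f x) (grad f x) / (2 * mu) by field; rewrite !gt_eqF.
  by rewrite ler_pdivlMr ?mulr_gt0// mulrC.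
have sm : - dot (grad f x) s <= Num.min Gamma (L / mu) * dot y s.
  rewrite /Num.min; case: ifP => _; last exact: sgk.
  by apply: le_trans sgm _; rewrite ler_wpM2r// ltW.
have m0 : 0 < Num.min Gamma (L / mu).
  rewrite lt_min k0 andbT; apply: lt_le_trans le_Gamma.
  by rewrite exprn_gt0// ltr_wpDr// !mulr_ge0 ?sqrtr_ge0// ltW.
have c0 : 0 < L / mu / 2 by rewrite divr_gt0.
have [p0 rate] := bfgs_step_rate S_pos m0 c0 yK fG sm.
split; first exact: p0.
move: rate; rewrite !SXS subrr addr0.
by have -> : 2 * (L / mu / 2) * Num.min Gamma (L / mu) =
  L / mu * Num.min Gamma (L / mu) by field; rewrite gt_eqF.
Qed.

End BfgsStep.

(** * The superlinear rate *)

Section SuperlinearRate.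
Context {R : realType}.

(** The bound by [k] keeps the induction going: while [k + 1 < u], the sum gains 1 and the minimum
    is still the first entry. *)
Lemma count_lt_le (u : R) k : 0 <= u ->
  \sum_(i < k) (i.+1%:R < u)%R%:R <= Num.min k%:R u.
Proof.
move=> u0; elim: k => [|k ih]; first by rewrite big_ord0 le_min lexx.
rewrite big_ord_recr /=; have [ku|uk] := ltP k.+1%:R u.
  by rewrite -natr1 lerD2r (le_trans ih)// ge_min lexx.
by rewrite addr0 (le_trans ih)// ge_min lexx orbT.
Qed.

(** With [rho = exp (- 1 / c)] the full series is [rho / (1 - rho)], at most [c] because
    [exp (1 / c) >= 1 + 1 / c]. *)
Lemma geometric_sum_le (c : R) k : 0 < c ->
  \sum_(i < k) expR (- (i.+1%:R / c)) <= c.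
Proof.
move=> c0; pose rho := expR (- c^-1).
have rho0 : 0 < rho by exact: expR_gt0.
have rhoE i : expR (- (i%:R / c)) = rho ^+ i.
  by rewrite /rho -expRM_natl mulrN.
have rho_le : rho <= c * (1 - rho).
  rewrite -subr_ge0.
  have : rho * (1 + c^-1) <= rho * expR c^-1 by rewrite ler_pM2l// expR_ge1Dx.
  rewrite -expRD addNr expR0 => h.
  have : c * (rho * (1 + c^-1)) <= c * 1 by rewrite ler_pM2l.
  have -> : c * (rho * (1 + c^-1)) = c * rho + rho by field; rewrite gt_eqF.
  lra.
suff : \sum_(i < k) expR (- (i.+1%:R / c)) <= c * (1 - rho ^+ k).
  move=> h; apply: le_trans h _; rewrite ler_piMr ?(ltW c0)//.
  by rewrite gerBl exprn_ge0// ltW.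
elim: k => [|k ih]; first by rewrite big_ord0 expr0 subrr mulr0.
rewrite big_ord_recr /= rhoE exprS.
have : rho ^+ k * rho <= rho ^+ k * (c * (1 - rho)).
  by rewrite ler_wpM2l// exprn_ge0// ltW.
move: (\sum_(i < k) _) (rho ^+ k) ih => s r ih h; lra.
Qed.

(** Jensen's inequality for [expR], by way of its tangent at [- s / k]. *)
Lemma sum_expR_ge (q : nat -> R) (s : R) k : (0 < k)%N ->
  \sum_(i < k) q i <= s ->
  k%:R * expR (- (s / k%:R)) <= \sum_(i < k) expR (- q i).
Proof.
move=> k0 qs; set c := - (s / k%:R).
have kR : (0 : R) < k%:R by rewrite ltr0n.
have tangent i : expR c * (1 - q i - c) <= expR (- q i).
  have -> : expR (- q i) = expR c * expR (- q i - c).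
    by rewrite -expRD addrC subrK.
  by rewrite ler_pM2l ?expR_gt0// -addrA expR_ge1Dx.
apply: (@le_trans _ _ (\sum_(i < k) expR c * (1 - q i - c))); last first.
  by apply: ler_sum => i _; exact: tangent.
rewrite -mulr_sumr mulrC ler_pM2l ?expR_gt0//.
rewrite !sumrB !sumr_const card_ord -[c *+ k]mulr_natr /c.
have -> : - (s / k%:R) * k%:R = - s by field; rewrite gt_eqF.
lra.
Qed.

Variables (delta q Psi1 Psi2 : nat -> R) (A K : R).
Hypothesis delta_gt0 : forall i, 0 < delta i.
Hypothesis deltaS : forall i, delta i.+1 = delta i * (1 - expR (- q i)).
Hypothesis Psi1_ge0 : forall i, 0 <= Psi1 i.
Hypothesis Psi2_ge0 : forall i, 0 <= Psi2 i.
Hypothesis A_ge0 : 0 <= A.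
Hypothesis K_gt0 : 0 < K.
Hypothesis q_le1 : forall i, q i <= A * Num.sqrt (delta i) + (Psi1 i - Psi1 i.+1).
Hypothesis q_le2 : forall i, q i <= ln K + (Psi2 i - Psi2 i.+1).

Lemma delta_le_expR k : delta k <= delta 0%N * expR (- \sum_(i < k) expR (- q i)).
Proof.
elim: k => [|k ih]; first by rewrite big_ord0 oppr0 expR0 mulr1.
rewrite big_ord_recr /= opprD expRD mulrA deltaS.
have f0 : 0 <= 1 - expR (- q k).
  by rewrite -(@pmulr_rge0 _ (delta k))// -deltaS ltW.
apply: ler_pM => //; first exact: ltW.
exact: expR_ge1Dx.
Qed.

Lemma delta_nonincreasing k : delta k <= delta 0%N.
Proof.
apply: le_trans (delta_le_expR k) _.
rewrite ler_piMr ?(ltW (delta_gt0 _))// expR_le1 oppr_le0.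
by apply: sumr_ge0 => i _; exact: expR_ge0.
Qed.

(** Past [2 Psi2 0] the factor [exp (- Psi2 0 / k)] is at least [1/2], so the sum of the
    [exp (- q i)] is at least [k / (2 K)]; the square root halves the exponent. *)
Lemma sqrt_delta_le k : (0 < k)%N -> 2 * Psi2 0%N <= k%:R ->
  Num.sqrt (delta k / delta 0%N) <= expR (- (k%:R / (4 * K))).
Proof.
move=> k0 kPsi; have kR : (0 : R) < k%:R by rewrite ltr0n.
have sum_q : \sum_(i < k) q i <= k%:R * ln K + Psi2 0%N.
  suff : \sum_(i < k) q i <= k%:R * ln K + (Psi2 0%N - Psi2 k).
    by have := Psi2_ge0 k; lra.
  elim: (k) => [|j ih]; first by rewrite big_ord0 subrr mul0r addr0.
  rewrite big_ord_recr /= -natr1; have := q_le2 j.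
  move: (\sum_(i < j) _) (ln K) ih => S l; lra.
have := sum_expR_ge k0 sum_q.
have -> : - ((k%:R * ln K + Psi2 0%N) / k%:R) = - ln K + - (Psi2 0%N / k%:R).
  by field; rewrite gt_eqF.
rewrite expRD expRN lnK ?posrE// => sum_ge.
have half : 2^-1 <= expR (- (Psi2 0%N / k%:R)).
  apply: le_trans (expR_ge1Dx _).
  have : Psi2 0%N / k%:R <= 2^-1 by rewrite ler_pdivrMr//; lra.
  lra.
rewrite -[expR _]ger0_norm ?expR_ge0// -sqrtr_sqr; apply: ler_wsqrtr.
rewrite -expRM_natl ler_pdivrMr// mulrC; apply: le_trans (delta_le_expR k) _.
rewrite ler_pM2l// ler_expR mulrN lerN2; apply: le_trans sum_ge.
have -> : 2 * (k%:R / (4 * K)) = k%:R * (K^-1 * 2^-1) by field; rewrite gt_eqF.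
by rewrite ler_pM2l// ler_pM2l ?invr_gt0.
Qed.

(** The 1 is the term of index 0, [2 Psi2 0] bounds the number of indices before the linear phase,
    and [4 K] is the geometric tail. *)
Lemma sum_sqrt_delta_le k :
  \sum_(i < k) Num.sqrt (delta i / delta 0%N) <= 2 * Psi2 0%N + 1 + 4 * K.
Proof.
have Psi0 := Psi2_ge0 0%N; have K0 := K_gt0.
have le1 i : Num.sqrt (delta i / delta 0%N) <= 1.
  rewrite -sqrtr1; apply: ler_wsqrtr; rewrite ler_pdivrMr// mul1r.
  exact: delta_nonincreasing.
case: k => [|k]; first by rewrite big_ord0; lra.
rewrite big_ord_recl /=.
have : \sum_(i < k) Num.sqrt (delta (bump 0 i) / delta 0%N) <=
  \sum_(i < k) ((i.+1%:R < 2 * Psi2 0%N)%R%:R + expR (- (i.+1%:R / (4 * K)))).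
  apply: ler_sum => i _; rewrite /bump /= add1n.
  have [_|h] := ltP i.+1%:R (2 * Psi2 0%N).
    by rewrite (le_trans (le1 _))// lerDl expR_ge0.
  by rewrite add0r; exact: sqrt_delta_le.
rewrite big_split /= => h.
have c1 : \sum_(i < k) (i.+1%:R < 2 * Psi2 0%N)%R%:R <= 2 * Psi2 0%N :> R.
  by apply: le_trans (count_lt_le k _) _; rewrite ?mulr_ge0// ge_min lexx orbT.
have c2 : \sum_(i < k) expR (- (i.+1%:R / (4 * K))) <= 4 * K.
  by apply: geometric_sum_le; rewrite mulr_gt0.
have := le1 0%N; move: h c1 c2.
move: (\sum_(i < k) _) (\sum_(i < k) _) (\sum_(i < k) _) (Num.sqrt _) => a b c e.
lra.
Qed.

Lemma superlinear_rate k : (0 < k)%N ->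
  delta k / delta 0%N <=
  ((Psi1 0%N + A * Num.sqrt (delta 0%N) * (2 * Psi2 0%N + 1 + 4 * K)) / k%:R) ^+ k.
Proof.
move=> k0; have kR : (0 : R) < k%:R by rewrite ltr0n.
have prodE : delta k / delta 0%N = \prod_(i < k) (1 - expR (- q i)).
  elim: (k) => [|j ih]; first by rewrite big_ord0 divff// gt_eqF.
  by rewrite big_ord_recr /= -ih deltaS; ring.
have f0 i : 0 <= 1 - expR (- q i).
  by rewrite -(@pmulr_rge0 _ (delta i))// -deltaS ltW.
have fq i : 1 - expR (- q i) <= q i by have := expR_ge1Dx (- q i); lra.
(* Positivity of all gaps forces this sign, which the inequality of means requires. *)
have q0 i : 0 <= q i by exact: le_trans (f0 i) (fq i).
rewrite prodE.
apply: (@le_trans _ _ (\prod_(i < k) q i)).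
  by apply: ler_prod => i _; rewrite f0 fq.
have [agm _] := @leif_AGM R 'I_k predT (fun i => q i) (fun i _ => q0 i).
rewrite cardT size_enum_ord in agm.
apply: le_trans agm _.
have sum_q : \sum_(i < k) q i <=
    Psi1 0%N + A * Num.sqrt (delta 0%N) * (2 * Psi2 0%N + 1 + 4 * K).
  apply: (@le_trans _ _ (A * \sum_(i < k) Num.sqrt (delta i) + Psi1 0%N)).
    suff : \sum_(i < k) q i <= A * \sum_(i < k) Num.sqrt (delta i) + (Psi1 0%N - Psi1 k).
      by have := Psi1_ge0 k; lra.
    elim: (k) => [|j ih]; first by rewrite !big_ord0 subrr mulr0 addr0.
    rewrite !big_ord_recr /=; have := q_le1 j.
    move: (\sum_(i < j) _) (\sum_(i < j) _) (Num.sqrt _) ih => S1 S2 l; lra.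
  rewrite addrC lerD2l -mulrA ler_wpM2l//.
  have -> : \sum_(i < k) Num.sqrt (delta i) =
      Num.sqrt (delta 0%N) * \sum_(i < k) Num.sqrt (delta i / delta 0%N).
    rewrite mulr_sumr; apply: eq_bigr => i _.
    by rewrite -sqrtrM ?(ltW (delta_gt0 _))// mulrC divfK// gt_eqF.
  by rewrite ler_wpM2l ?sqrtr_ge0// sum_sqrt_delta_le.
have sum0 : 0 <= \sum_(i < k) q i by apply: sumr_ge0.
rewrite lerXn2r ?nnegrE ?divr_ge0 ?(ltW kR)//; first exact: le_trans sum_q.
by rewrite ler_pM2r// invr_gt0.
Qed.

End SuperlinearRate.

Unset Implicit Arguments.

Theorem theorem5 (R : realType) (n : nat) (f : 'cV[R]_n -> R)
    (mu L M L2 : R) (xs x0 : 'cV[R]_n) (B0 : 'M[R]_n)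
    (x : nat -> 'cV[R]_n) (B : nat -> 'M[R]_n) :
  0 < mu -> 0 < L -> 0 < M -> 0 < L2 ->
  cont_diff 3 f ->
  strongly_convex mu f ->
  lipschitz_grad L f ->
  self_concordant M f ->
  lipschitz_hess L2 f ->
  let Mt := L2 / (2 * mu `^ (3 / 2)) in
  M <= Mt ->
  let kappa := L / mu in
  (forall z, f xs <= f z) ->
  posdefmx B0 ->
  sa_adaptive_bfgs f L M x0 B0 x B ->
  (forall k, grad f (x k) != 0) ->
  let Delta := f x0 - f xs in
  let Bbar0 := L^-1 *: B0 in
  let invsqrtH := sqrtmx (invmx (hess f xs)) in
  let Btilde0 := invsqrtH *m B0 *m invsqrtH in
  let Gamma := (1 + Num.sqrt 2 * M * Num.sqrt Delta) ^+ 2 in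
  forall k : nat, (1 <= k)%N ->
    (f (x k) - f xs) / Delta <=
    ((Psi Btilde0
      + 8 * Num.sqrt 2 * Mt * Num.sqrt Delta
        * (2 * Psi Bbar0 + 1 + 4 * kappa * Num.min Gamma kappa)) / k%:R) ^+ k.
Proof.
move=> mu_gt0 L_gt0 M_gt0 L2_gt0 fC f_sc f_grad f_conc f_hess Mt MMt kappa.
move=> xs_min B0_pos [x00 B00 step] g_neq0 Delta Bbar0 S Btilde0 Gamma k k_gt0.
have fC2 := cont_diffW fC.
have kappa0 : 0 < kappa by rewrite divr_gt0.
have stepx i : x i.+1 = x i + bfgs_stepsize f L M (x i) (bfgs_dir f (x i) (B i))
    *: bfgs_dir f (x i) (B i) by have [] := step i.
have stepB i : B i.+1 = bfgs_update (B i)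
    (bfgs_stepsize f L M (x i) (bfgs_dir f (x i) (B i)) *: bfgs_dir f (x i) (B i))
    (grad f (x i.+1) - grad f (x i)).
  by have [xi ->] := step i; congr bfgs_update; rewrite xi addrC addKr.
have B_pos i : posdefmx (B i).
  elim: i => [|i Bi]; first by rewrite B00.
  rewrite stepB stepx.
  exact: (bfgs_step_posdef mu_gt0 L_gt0 M_gt0 fC f_sc f_grad f_conc xs_min Bi (g_neq0 i)).
have super i : 0 < f (x i) - f (x i.+1) /\
    ln ((f (x i) - f xs) / (f (x i) - f (x i.+1))) <=
    4 * hess_drift mu L2 (f (x i) - f xs) +
    (Psi (S *m B i *m S) - Psi (S *m B i.+1 *m S)).
  rewrite stepB stepx.
  exact: (bfgs_step_superlinear mu_gt0 L_gt0 M_gt0 fC f_sc f_grad f_conc xs_min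
    (B_pos i) (g_neq0 i) L2_gt0 f_hess MMt).
pose delta i := f (x i) - f xs.
have delta_gt0 i : 0 < delta i.
  by rewrite subr_gt0; exact: (grad_neq0_gt_min mu_gt0 fC2 f_sc xs_min).
(* Monotonicity of the gap lets the initial [Gamma] dominate the factor of every later step. *)
have Delta_ge i : delta i <= Delta.
  rewrite /Delta -x00; elim: i => [|i ih]; first exact: lexx.
  apply: le_trans ih; rewrite lerD2r -subr_ge0.
  by have [/ltW] := super i.
have linear i : ln (delta i / (f (x i) - f (x i.+1))) <=
    ln (kappa * Num.min Gamma kappa) + (Psi (L^-1 *: B i) - Psi (L^-1 *: B i.+1)).
  rewrite stepB stepx.
  apply: (bfgs_step_linear mu_gt0 L_gt0 M_gt0 fC f_sc f_grad f_conc xs_min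
    (B_pos i) (g_neq0 i) _).2.
  rewrite lerXn2r ?nnegrE ?addr_ge0 ?mulr_ge0 ?sqrtr_ge0 ?(ltW M_gt0)//.
  rewrite lerD2l ler_wpM2l ?mulr_ge0 ?sqrtr_ge0 ?(ltW M_gt0)//.
  exact/ler_wsqrtr/Delta_ge.
have Gamma0 : 0 < Gamma.
  apply: exprn_gt0; apply: ltr_wpDr ltr01.
  apply: mulr_ge0; last exact: sqrtr_ge0.
  by apply: mulr_ge0; [exact: sqrtr_ge0|exact: ltW].
have deltaS i : delta i.+1 =
    delta i * (1 - expR (- ln (delta i / (f (x i) - f (x i.+1))))).
  have [p0 _] := super i; have d0 := delta_gt0 i.
  rewrite -lnV ?posrE ?divr_gt0// lnK ?posrE ?invr_gt0 ?divr_gt0// invf_div.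
  by rewrite mulrBr mulr1 mulrC divfK ?gt_eqF// /delta; ring.
have S_pos : posdefmx S.
  exact: (sqrtmxP (posdefmx_inv (hess_posdef mu_gt0 fC2 f_sc xs))).1.
have Psi1_ge0 i : 0 <= Psi (S *m B i *m S).
  have [Ssym _] := S_pos; rewrite -{2}Ssym.
  by apply/Psi_ge0/posdefmx_congr/B_pos/posdefmx_unit.
have Psi2_ge0 i : 0 <= Psi (L^-1 *: B i).
  apply: Psi_ge0; have [Bsym Bp] := B_pos i.
  split; first by rewrite linearZ /= Bsym.
  by move=> v v0; rewrite -scalemxAl dotZr mulr_gt0 ?invr_gt0// Bp.
have Mt0 : 0 <= Mt by exact: le_trans (ltW M_gt0) MMt.
have A0 : 0 <= 8 * Num.sqrt 2 * Mt by rewrite mulr_ge0// mulr_ge0 ?sqrtr_ge0.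
have K0 : 0 < kappa * Num.min Gamma kappa by rewrite mulr_gt0// lt_min Gamma0.
(* The 8 is the 4 of the one-step bound times the 2 inside [hess_drift]. *)
have q1 i : ln (delta i / (f (x i) - f (x i.+1))) <=
    8 * Num.sqrt 2 * Mt * Num.sqrt (delta i)
    + (Psi (S *m B i *m S) - Psi (S *m B i.+1 *m S)).
  have [_] := super i; rewrite /hess_drift -/Mt.
  by congr (_ <= _ + _); rewrite !mulrA -natrM.
have := superlinear_rate delta_gt0 deltaS Psi1_ge0 Psi2_ge0 A0 K0 q1 linear k_gt0.
by rewrite /delta x00 B00 mulrA.
Qed.
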